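(* Let $\Bbbk$ be a commutative ring and $0\le m\le+\infty$. There exist bijections $$\mathrm{MDer}^m_{\Bbbk}(M_A,N_B)\cong\mathrm{Meas}(M_A,C_m,N_B)\cong\mathsf{Comod}(C_m,Q(M_A,N_B))\cong\mathsf{Mod}(C_m\triangleright M_A,N_B)$$ natural in $M_A,N_B\in\mathsf{Mod}$. There is a category with objects given by the modules $M_A$ and homs given by the sets $\mathrm{MDer}^m_{\Bbbk}(M_A,N_B)$.
   Context: Algebras are associative unital $\Bbbk$-algebras, not necessarily commutative. $\mathsf{Mod}$ is the category whose objects $M_A$ are right modules $M$ over a $\Bbbk$-algebra $A$, and whose morphisms $M_A\to N_B$ are pairs $(p,f)$ with $f\colon A\to B$ an algebra morphism and $p\colon M\to N$ $\Bbbk$-linear with $p(x\cdot a)=p(x)\cdot f(a)$. $\mathsf{Comod}$ is the category whose objects $X_C$ are right comodules $X$ over a $\Bbbk$-coalgebra $C$, with coaction $\chi$, and whose morphisms $X_C\to Y_D$ are pairs $(k,g)$ with $g\colon C\to D$ a coalgebra morphism and $k\colon X\to Y$ $\Bbbk$-linear with $\chi\circ k=(k\otimes g)\circ\chi$. A higher derivation of length $m$ from $A$ to $B$ is a family of $\Bbbk$-linear maps $D=(D_k\colon A\to B)_{0\le k\le m}$ (all $k\in\mathbb{N}$ if $m=+\infty$) with $D_0$ an algebra morphism and $D_k(xy)=\sum_{i+j=k}D_i(x)D_j(y)$. A module $D$-derivation from $M_A$ to $N_B$ of length $m$ is a family of $\Bbbk$-linear maps $(d_i\colon M\to N)_{0\le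 i\le m}$ with $d_k(x\cdot a)=\sum_{i+j=k}d_i(x)\cdot D_j(a)$ for $x\in M$, $a\in A$. $\mathrm{MDer}^m_{\Bbbk}(M_A,N_B)$ is the set of all module derivations of length $m$ from $M_A$ to $N_B$, i.e. of pairs $(D,d)$ with $D$ a higher derivation of length $m$ from $A$ to $B$ and $d$ a module $D$-derivation. $C_m$ is the $\Bbbk$-coalgebra free as a $\Bbbk$-module on $\{v_i:0\le i\le m\}$ ($i\in\mathbb{N}$ if $m=+\infty$), with $\Delta(v_k)=\sum_{i+j=k}v_i\otimes v_j$, $\varepsilon(v_k)=\delta_{0,k}$; it is regarded as a right comodule over itself. For $X_C\in\mathsf{Comod}$ with coaction $x\mapsto\sum x_0\otimes x_1$, $\mathrm{Meas}(M_A,X_C,N_B)$ is the set of module measurings: pairs $(\phi,\psi)$ of $\Bbbk$-linear maps $\phi\colon A\otimes C\to B$ and $\psi\colon M\otimes X\to N$ such that $\phi(aa'\otimes c)=\sum\phi(a\otimes c_1)\phi(a'\otimes c_2)$, $\phi(1\otimes c)=\varepsilon(c)1$, and $\psi((u\cdot a)\otimes x)=\sum\psi(u\otimes x_0)\cdot\phi(a\otimes x_1)$. Equivalently, these are morphisms $M_A\to[X,N]_{[C,B]}$ in $\mathsf{Mod}$, where $[X,N]=\mathrm{Hom}_{\Bbbk}(X,N)$ is a module over the convolution algebra $[C,B]=\mathrm{Hom}_{\Bbbk}(C,B)$. $Q(M_A,N_B)$, the universal measuring comodule, represents $X_C\mapsto\mathrm{Meas}(M_A,X_C,N_B)$ on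 $\mathsf{Comod}$. $X_C\triangleright-$ denotes the left adjoint of $[X_C,-]\colon\mathsf{Mod}\to\mathsf{Mod}$, $N_B\mapsto[X,N]_{[C,B]}$ (the tensor of the $\mathsf{Comod}$-enriched category of modules). Both $Q$ and $\triangleright$ exist in this setting. *)

(* Defs.v *)
From HB Require Import structures.
From mathcomp Require Import all_boot all_order all_algebra.
From mathcomp Require Import generic_quotient.
From mathcomp Require Import boolp classical_sets functions.

Set Implicit Arguments.
Unset Strict Implicit.
Unset Printing Implicit Defensive.

Import GRing.Theory.

Local Open Scope ring_scope.
Local Open Scope quotient_scope.

Section LinHom.
Context {k : comPzRingType} {U V : lmodType k}.
Implicit Types f g h : {linear U -> V}.

Lemma lin_ext f g : f =1 g -> f = g.
Proof.
case: f g => [f [[f1] [f2]]] [g [[g1] [g2]]] /= /funext fg.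
move: f1 f2; rewrite {}fg => f1 f2.
by rewrite (Prop_irrelevance f1 g1) (Prop_irrelevance f2 g2).
Qed.

Definition mklin_fun (p : U -> V) (_ : linear p) : U -> V := p.
HB.instance Definition _ (p : U -> V) (lp : linear p) :=
  GRing.isLinear.Build k U V *:%R (mklin_fun lp) lp.
Definition mklin (p : U -> V) (lp : linear p) : {linear U -> V} := mklin_fun lp.

HB.instance Definition _ := gen_eqMixin {linear U -> V}.
HB.instance Definition _ := gen_choiceMixin {linear U -> V}.

Definition lin_zero : {linear U -> V} := \0.
Definition lin_opp f : {linear U -> V} := \- f.
Definition lin_add f g : {linear U -> V} := f \+ g.

Definition lin_scale_fun (c : k) f (x : U) : V := c *: f x.
Lemma lin_scale_linear c f : linear (lin_scale_fun c f).
Proof.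
move=> a x y; rewrite /lin_scale_fun linearP scalerDr !scalerA.
by rewrite [c * a]mulrC.
Qed.
Definition lin_scale c f : {linear U -> V} := mklin (lin_scale_linear c f).

Lemma lin_scaleE c f x : lin_scale c f x = c *: f x. Proof. by []. Qed.

Lemma lin_addA : associative lin_add.
Proof. by move=> f g h; apply: lin_ext => x /=; rewrite addrA. Qed.
Lemma lin_addC : commutative lin_add.
Proof. by move=> f g; apply: lin_ext => x /=; rewrite addrC. Qed.
Lemma lin_add0 : left_id lin_zero lin_add.
Proof. by move=> f; apply: lin_ext => x /=; rewrite add0r. Qed.
Lemma lin_addN : left_inverse lin_zero lin_opp lin_add.
Proof. by move=> f; apply: lin_ext => x /=; rewrite addNr. Qed.
HB.instance Definition _ := GRing.isZmodule.Build {linear U -> V}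
  lin_addA lin_addC lin_add0 lin_addN.

Lemma lin_scaleA a b f : lin_scale a (lin_scale b f) = lin_scale (a * b) f.
Proof. by apply: lin_ext => x; rewrite !lin_scaleE scalerA. Qed.
Lemma lin_scale1 : left_id 1 lin_scale.
Proof. by move=> f; apply: lin_ext => x; rewrite lin_scaleE scale1r. Qed.
Lemma lin_scaleDr : right_distributive lin_scale +%R.
Proof.
by move=> a f g; apply: lin_ext => x; rewrite /= !lin_scaleE scalerDr.
Qed.
Lemma lin_scaleDl f : {morph lin_scale^~ f : a b / a + b}.
Proof.
by move=> a b; apply: lin_ext => x; rewrite /= !lin_scaleE scalerDl.
Qed.
HB.instance Definition _ := GRing.Zmodule_isLmodule.Build k {linear U -> V}
  lin_scaleA lin_scale1 lin_scaleDr lin_scaleDl.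

End LinHom.

Arguments mklin : simpl never.

Definition lcomp (k : comPzRingType) (U V W : lmodType k)
  (g : {linear V -> W}) (f : {linear U -> V}) : {linear U -> W} := g \o f.

Definition lid (k : comPzRingType) (U : lmodType k) : {linear U -> U} := idfun.

Lemma lcompE (k : comPzRingType) (U V W : lmodType k)
  (g : {linear V -> W}) (f : {linear U -> V}) x : lcomp g f x = g (f x).
Proof. by []. Qed.

Lemma lidE (k : comPzRingType) (U : lmodType k) x : lid U x = x.
Proof. by []. Qed.

Arguments lcomp : simpl never.
Arguments lid : simpl never.

Definition bilin (k : comPzRingType) (U V W : lmodType k) (f : U -> V -> W) :=
  (forall y, linear (f^~ y)) /\ (forall x, linear (f x)).

(* Formal sums [:: (x1, y1); ...; (xn, yn)] stand for x1 ⊗ y1 + ... + xn ⊗ yn. *)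
Inductive tensor_eq (k : comPzRingType) (U V : lmodType k) :
    seq (U * V) -> seq (U * V) -> Prop :=
| TeRefl s : tensor_eq s s
| TeSym s t : tensor_eq s t -> tensor_eq t s
| TeTrans s t u : tensor_eq s t -> tensor_eq t u -> tensor_eq s u
| TeCat s s' t t' : tensor_eq s s' -> tensor_eq t t' ->
    tensor_eq (s ++ t) (s' ++ t')
| TeCatC s t : tensor_eq (s ++ t) (t ++ s)
| TeZero y : tensor_eq [:: (0, y)] [::]
| TeAddl x x' y : tensor_eq [:: (x + x', y)] [:: (x, y); (x', y)]
| TeAddr x y y' : tensor_eq [:: (x, y + y')] [:: (x, y); (x, y')]
| TeScale c x y : tensor_eq [:: (c *: x, y)] [:: (x, c *: y)].

Section Tensor.
Context {k : comPzRingType} {U V : lmodType k}.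

Definition tensor_rel (s t : seq (U * V)) : bool := `[< tensor_eq s t >].

Lemma tensor_rel_refl : reflexive tensor_rel.
Proof. by move=> s; apply/asboolP; apply: TeRefl. Qed.
Lemma tensor_rel_sym : symmetric tensor_rel.
Proof. by move=> s t; apply/asboolP/asboolP; apply: TeSym. Qed.
Lemma tensor_rel_trans : transitive tensor_rel.
Proof.
by move=> t s u /asboolP st /asboolP tu; apply/asboolP; apply: TeTrans st tu.
Qed.
Canonical tensor_equiv :=
  EquivRel tensor_rel tensor_rel_refl tensor_rel_sym tensor_rel_trans.
End Tensor.

Definition tensor (k : comPzRingType) (U V : lmodType k) : Type :=
  {eq_quot (@tensor_rel k U V)}.

Notation "U ⊗ V" := (tensor U V) (at level 40, left associativity) : type_scope.

Section TensorTheory.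
Context {k : comPzRingType} {U V : lmodType k}.

HB.instance Definition _ := EqQuotient.on (tensor U V).
HB.instance Definition _ := Choice.on (tensor U V).

Definition tcls (s : seq (U * V)) : U ⊗ V := \pi_(tensor U V) s.

Lemma tclsP s t : tcls s = tcls t <-> tensor_eq s t.
Proof.
rewrite /tcls; split => [/eqmodP/asboolP //|st].
by apply/eqmodP/asboolP.
Qed.

Lemma tcls_repr (t : U ⊗ V) : tcls (repr t) = t.
Proof. exact: reprK. Qed.

Lemma repr_tcls s : tensor_eq (repr (tcls s)) s.
Proof. by apply/tclsP; rewrite tcls_repr. Qed.

Lemma tclsW (P : U ⊗ V -> Prop) : (forall s, P (tcls s)) -> forall t, P t.
Proof. by move=> H t; rewrite -[t]tcls_repr. Qed.

Definition fscale (c : k) (s : seq (U * V)) := [seq (c *: p.1, p.2) | p <- s].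

Lemma fscale_eq c s t : tensor_eq s t -> tensor_eq (fscale c s) (fscale c t).
Proof.
elim=> {s t} /=.
- by move=> s; apply: TeRefl.
- by move=> s t _; apply: TeSym.
- by move=> s t u _ IH1 _; apply: TeTrans.
- by move=> s s' t t' _ IH1 _ IH2; rewrite /fscale !map_cat; apply: TeCat.
- by move=> s t; rewrite /fscale !map_cat; apply: TeCatC.
- by move=> y; rewrite scaler0; apply: TeZero.
- by move=> x x' y; rewrite scalerDr; apply: TeAddl.
- by move=> x y y'; apply: TeAddr.
- by move=> d x y; rewrite scalerA mulrC -scalerA; apply: TeScale.
Qed.

Definition tadd (t u : U ⊗ V) := tcls (repr t ++ repr u).
Definition tscale (c : k) (t : U ⊗ V) := tcls (fscale c (repr t)).
Definition topp (t : U ⊗ V) := tscale (-1) t.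

Lemma tadd_cls s t : tadd (tcls s) (tcls t) = tcls (s ++ t).
Proof. by apply/tclsP; apply: TeCat; apply: repr_tcls. Qed.
Lemma tscale_cls c s : tscale c (tcls s) = tcls (fscale c s).
Proof. by apply/tclsP; apply: fscale_eq; apply: repr_tcls. Qed.

Lemma taddA : associative tadd.
Proof.
elim/tclsW => s; elim/tclsW => t; elim/tclsW => u.
by rewrite !tadd_cls catA.
Qed.
Lemma taddC : commutative tadd.
Proof.
by elim/tclsW => s; elim/tclsW => t; rewrite !tadd_cls; apply/tclsP/TeCatC.
Qed.
Lemma tadd0 : left_id (tcls [::]) tadd.
Proof. by elim/tclsW => s; rewrite tadd_cls. Qed.

Lemma fscaleDl a b s :
  tensor_eq (fscale (a + b) s) (fscale a s ++ fscale b s).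
Proof.
elim: s => [|[x y] s IH] /=; first exact: TeRefl.
rewrite scalerDl -cat1s.
apply: TeTrans (TeCat (TeAddl _ _ _) IH) _ => /=.
rewrite -[X in tensor_eq X _]/([:: (a *: x, y)] ++ _).
rewrite -[X in tensor_eq _ X]/([:: (a *: x, y)] ++ _); apply: TeCat (TeRefl _) _.
rewrite -[X in tensor_eq X _]/([:: (b *: x, y)] ++ _).
rewrite -[X in tensor_eq _ (_ ++ X)]/([:: (b *: x, y)] ++ _) !catA.
exact: TeCat (TeCatC _ _) (TeRefl _).
Qed.

Lemma fscale0 s : tensor_eq (fscale 0 s) [::].
Proof.
elim: s => [|[x y] s IH] /=; first exact: TeRefl.
by rewrite scale0r; have := TeCat (TeZero _ y) IH.
Qed.

Lemma fscale1 s : fscale 1 s = s.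
Proof. by elim: s => //= -[x y] s ->; rewrite scale1r. Qed.

Lemma taddN : left_inverse (tcls [::]) topp tadd.
Proof.
elim/tclsW => s; rewrite /topp tscale_cls tadd_cls; apply/tclsP.
apply: TeTrans (fscale0 s); rewrite -[in fscale 0 s](addNr 1).
by apply: TeSym; rewrite -{3}(fscale1 s); apply: fscaleDl.
Qed.

HB.instance Definition _ := GRing.isZmodule.Build (tensor U V)
  taddA taddC tadd0 taddN.

Lemma tscaleA a b t : tscale a (tscale b t) = tscale (a * b) t.
Proof.
elim/tclsW: t => s; rewrite !tscale_cls; congr tcls.
by rewrite /fscale -map_comp; apply: eq_map => p /=; rewrite scalerA.
Qed.
Lemma tscale1 : left_id 1 tscale.
Proof. by elim/tclsW => s; rewrite tscale_cls fscale1. Qed.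
Lemma tscaleDr : right_distributive tscale +%R.
Proof.
move=> a; elim/tclsW => s; elim/tclsW => t.
by rewrite [_ + _]tadd_cls !tscale_cls [RHS]tadd_cls /fscale map_cat.
Qed.
Lemma tscaleDl t : {morph tscale^~ t : a b / a + b}.
Proof.
move=> a b; elim/tclsW: t => s.
by rewrite !tscale_cls [RHS]tadd_cls; apply/tclsP/fscaleDl.
Qed.
HB.instance Definition _ := GRing.Zmodule_isLmodule.Build k (tensor U V)
  tscaleA tscale1 tscaleDr tscaleDl.

Definition tens (x : U) (y : V) : U ⊗ V := tcls [:: (x, y)].

Lemma tens_bilin : bilin tens.
Proof.
split=> [y a x x'|x a y y'].
  rewrite -[RHS]/(tadd (tscale a (tens x y)) (tens x' y)) tscale_cls tadd_cls.
  exact/tclsP/TeAddl.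
rewrite -[RHS]/(tadd (tscale a (tens x y)) (tens x y')) tscale_cls tadd_cls.
apply/tclsP; apply: TeTrans (TeAddr _ _ _) _.
exact: (TeCat (TeSym (TeScale a x y)) (TeRefl [:: (x, y')])).
Qed.

Lemma tclsE s : tcls s = \sum_(p <- s) tens p.1 p.2.
Proof.
elim: s => [|[x y] s IH]; first by rewrite big_nil.
by rewrite big_cons -IH [RHS]tadd_cls.
Qed.

Lemma tensor_ext (W : lmodType k) (f g : {linear U ⊗ V -> W}) :
  (forall x y, f (tens x y) = g (tens x y)) -> f = g.
Proof.
move=> fg; apply: lin_ext; elim/tclsW => s; rewrite tclsE !linear_sum.
by apply: eq_bigr => p _; apply: fg.
Qed.

End TensorTheory.

(* For t = x1 ⊗ y1 + ... + xn ⊗ yn this is f x1 y1 + ... + f xn yn, i.e. the    *)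
(* value at t of the linear map out of the tensor product induced by f. The    *)
(* representative of t is immaterial when f is bilinear (tsum_cls).            *)
Definition tsum (k : comPzRingType) (U V W : lmodType k) (f : U -> V -> W)
  (t : U ⊗ V) : W := \sum_(p <- repr t) f p.1 p.2.

Notation "\tsum_ ( x , y <- t ) E" := (tsum (fun x y => E) t)
  (at level 41, x name, y name, t at level 100, E at level 41,
   format "\tsum_ ( x ,  y  <-  t )  E") : ring_scope.

Notation "x ⊗t y" := (tens x y) (at level 40, left associativity) : ring_scope.

Section Tsum.
Context {k : comPzRingType} {U V W : lmodType k}.
Implicit Types f : U -> V -> W.

Lemma bilin0l f : bilin f -> forall y, f 0 y = 0.
Proof.
by case=> fl _ y; have := fl y (-1) 0 0; rewrite scaler0 addr0 scaleN1r addNr.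
Qed.
Lemma bilinDl f : bilin f -> forall x x' y, f (x + x') y = f x y + f x' y.
Proof. by case=> fl _ x x' y; have := fl y 1 x x'; rewrite !scale1r. Qed.
Lemma bilinDr f : bilin f -> forall x y y', f x (y + y') = f x y + f x y'.
Proof. by case=> _ fr x y y'; have := fr x 1 y y'; rewrite !scale1r. Qed.
Lemma bilinZl f : bilin f -> forall c x y, f (c *: x) y = c *: f x y.
Proof.
move=> bf c x y; have [fl _] := bf; have := fl y c x 0.
by rewrite !addr0 bilin0l // addr0.
Qed.
Lemma bilin0r f : bilin f -> forall x, f x 0 = 0.
Proof. by case=> _ fr x; have := fr x (-1) 0 0; rewrite scaler0 addr0 scaleN1r addNr. Qed.
Lemma bilinZr f : bilin f -> forall c x y, f x (c *: y) = c *: f x y.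
Proof.
move=> bf c x y; have [_ fr] := bf; have := fr x c y 0.
by rewrite !addr0 bilin0r // addr0.
Qed.

Lemma tsum_eq f s t : bilin f -> tensor_eq s t ->
  \sum_(p <- s) f p.1 p.2 = \sum_(p <- t) f p.1 p.2.
Proof.
move=> bf; elim=> {s t} //=.
- by move=> s t u _ -> _ ->.
- by move=> s s' t t' _ IH1 _ IH2; rewrite !big_cat /= IH1 IH2.
- by move=> s t; rewrite !big_cat /= addrC.
- by move=> y; rewrite big_seq1 big_nil bilin0l.
- by move=> x x' y; rewrite big_seq1 !big_cons big_nil addr0 bilinDl.
- by move=> x y y'; rewrite big_seq1 !big_cons big_nil addr0 bilinDr.
- by move=> c x y; rewrite !big_seq1 bilinZl // bilinZr.
Qed.

Lemma tsum_cls f s : bilin f -> tsum f (tcls s) = \sum_(p <- s) f p.1 p.2.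
Proof. by move=> bf; apply: tsum_eq => //; apply: repr_tcls. Qed.

Lemma tsum_tens f : bilin f -> forall x y, tsum f (x ⊗t y) = f x y.
Proof. by move=> bf x y; rewrite tsum_cls // big_seq1. Qed.

Lemma tsum_linear f : bilin f -> linear (tsum f).
Proof.
move=> bf a t u; rewrite -[t]tcls_repr -[u]tcls_repr.
move: (repr t) (repr u) => {t u} s t.
rewrite -[a *: _ + _]/(tadd (tscale a (tcls s)) (tcls t)).
rewrite tscale_cls tadd_cls !tsum_cls //.
rewrite big_cat scaler_sumr big_map /=; congr (_ + _).
by apply: eq_bigr => p _; rewrite bilinZl.
Qed.

Lemma eq_tsum f g t : (forall x y, f x y = g x y) -> tsum f t = tsum g t.
Proof. by move=> fg; apply: eq_bigr => p _; apply: fg. Qed.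

End Tsum.

Section Tlift.
Context {k : comPzRingType} {U V W : lmodType k}.

Definition tlift (f : U -> V -> W) (bf : bilin f) : {linear U ⊗ V -> W} :=
  mklin (tsum_linear bf).

Lemma tlift_tens f (bf : bilin f) x y : tlift bf (x ⊗t y) = f x y.
Proof. exact: tsum_tens. Qed.

End Tlift.

Arguments tlift : simpl never.

Section Tmap.
Context {k : comPzRingType}.

Lemma bilin_comp (U U' V V' W W' : lmodType k) (f : U' -> V' -> W)
    (g : {linear U -> U'}) (h : {linear V -> V'}) (l : {linear W -> W'}) :
  bilin f -> bilin (fun x y => l (f (g x) (h y))).
Proof.
by move=> [fl fr]; split=> [y a x x'|x a y y']; rewrite linearP ?fl ?fr linearP.
Qed.

Definition tmap (U U' V V' : lmodType k)
    (g : {linear U -> U'}) (h : {linear V -> V'}) : {linear U ⊗ V -> U' ⊗ V'} :=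
  tlift (bilin_comp g h (lid _) tens_bilin).

Arguments tmap : simpl never.

Lemma tmap_tens (U U' V V' : lmodType k)
    (g : {linear U -> U'}) (h : {linear V -> V'}) x y :
  tmap g h (x ⊗t y) = g x ⊗t h y.
Proof. exact: tlift_tens. Qed.

Lemma tsum_tmap (U U' V V' W : lmodType k)
    (g : {linear U -> U'}) (h : {linear V -> V'}) (f : U' -> V' -> W) t :
  bilin f -> tsum f (tmap g h t) = \tsum_(x, y <- t) f (g x) (h y).
Proof.
move=> bf; have bf' := bilin_comp g h (lid _) bf.
rewrite -[LHS]/(lcomp (tlift bf) (tmap g h) t) -[RHS]/(tlift bf' t).
congr (GRing.Linear.sort _ t); apply: tensor_ext => x y.
by rewrite lcompE tmap_tens !tlift_tens.
Qed.

Lemma tmap_id (U V : lmodType k) : tmap (lid U) (lid V) = lid _.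
Proof. by apply: tensor_ext => x y; rewrite tmap_tens. Qed.

Lemma tmap_comp (U1 U2 U3 V1 V2 V3 : lmodType k)
    (g' : {linear U2 -> U3}) (g : {linear U1 -> U2})
    (h' : {linear V2 -> V3}) (h : {linear V1 -> V2}) :
  tmap (lcomp g' g) (lcomp h' h) = lcomp (tmap g' h') (tmap g h).
Proof. by apply: tensor_ext => x y; rewrite lcompE !tmap_tens. Qed.

Lemma tmap_compE (U1 U2 U3 V1 V2 V3 : lmodType k)
    (g' : {linear U2 -> U3}) (g : {linear U1 -> U2})
    (h' : {linear V2 -> V3}) (h : {linear V1 -> V2}) t :
  tmap g' h' (tmap g h t) = tmap (lcomp g' g) (lcomp h' h) t.
Proof. by rewrite tmap_comp. Qed.

Lemma lin_tsum (U V W W' : lmodType k) (l : {linear W -> W'})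
  (f : U -> V -> W) t : l (tsum f t) = \tsum_(x, y <- t) l (f x y).
Proof. exact: linear_sum. Qed.

End Tmap.

Section Tassoc.
Context {k : comPzRingType} {U V W : lmodType k}.

Definition trilin (T : lmodType k) (f : U -> V -> W -> T) :=
  [/\ forall y z, linear (fun x => f x y z),
      forall x z, linear (fun y => f x y z) & forall x y, linear (f x y)].

Section Trilin.
Context {T : lmodType k} {f : U -> V -> W -> T} (tf : trilin f).

Lemma trilin12 z : bilin (fun x y => f x y z).
Proof. by case: tf => f1 f2 f3; split=> [y|x]; [apply: f1 | apply: f2]. Qed.

Lemma trilin23 x : bilin (f x).
Proof. by case: tf => f1 f2 f3; split=> [z|y]; [apply: f2 | apply: f3]. Qed.

Lemma trilinl : bilin (fun w z => \tsum_(x, y <- w) f x y z).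
Proof.
split=> [z|w a z z']; first exact: (tsum_linear (trilin12 z)).
rewrite /tsum scaler_sumr -big_split.
by apply: eq_bigr => p _; case: tf => _ _ ->.
Qed.

Lemma trilinr : bilin (fun x w => \tsum_(y, z <- w) f x y z).
Proof.
split=> [w a x x'|x]; last exact: (tsum_linear (trilin23 x)).
rewrite /tsum scaler_sumr -big_split.
by apply: eq_bigr => p _; case: tf => -> _ _.
Qed.
End Trilin.

Lemma tens_trilin : trilin (fun (x : U) (y : V) (z : W) => x ⊗t (y ⊗t z)).
Proof.
have [tl tr] := @tens_bilin k U (V ⊗ W).
have [tl' tr'] := @tens_bilin k V W.
by split=> [y z a x x'|x z a y y'|x y a z z']; rewrite ?tl' ?tr' ?tl ?tr.
Qed.

Definition tassoc : {linear (U ⊗ V) ⊗ W -> U ⊗ (V ⊗ W)} :=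
  tlift (trilinl tens_trilin).

Lemma tassoc_tens x y z : tassoc ((x ⊗t y) ⊗t z) = x ⊗t (y ⊗t z).
Proof. by rewrite tlift_tens (tsum_tens (trilin12 tens_trilin z)). Qed.

Lemma tensor3_ext (T : lmodType k) (f g : {linear (U ⊗ V) ⊗ W -> T}) :
  (forall x y z, f ((x ⊗t y) ⊗t z) = g ((x ⊗t y) ⊗t z)) -> f = g.
Proof.
move=> fg; apply: tensor_ext => w z.
have bz (h : {linear (U ⊗ V) ⊗ W -> T}) : linear (fun w => h (w ⊗t z)).
  by move=> a u u'; rewrite (bilinDl tens_bilin) (bilinZl tens_bilin) linearP.
suff /(congr1 (fun h : {linear U ⊗ V -> T} => h w)) :
  mklin (bz f) = mklin (bz g) by [].
by apply: tensor_ext => x y; apply: fg.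
Qed.

Lemma tsum_tassoc (T : lmodType k) (f : U -> V -> W -> T) t : trilin f ->
  \tsum_(w, z <- t) (\tsum_(x, y <- w) f x y z) =
  \tsum_(x, w <- tassoc t) (\tsum_(y, z <- w) f x y z).
Proof.
move=> tf; rewrite -[LHS]/(tlift (trilinl tf) t).
rewrite -[RHS]/(lcomp (tlift (trilinr tf)) tassoc t).
congr (GRing.Linear.sort _ t); apply: tensor3_ext => x y z.
rewrite lcompE tassoc_tens !tlift_tens.
by rewrite (tsum_tens (trilin12 tf z)) (tsum_tens (trilin23 tf x)).
Qed.

End Tassoc.

Arguments tassoc : simpl never.

(* MathComp's algType excludes the zero algebra, which convolution algebras    *)
(* may be.                                                                     *)
Record algebra (k : comPzRingType) := Algebra {
  alg_mod : lmodType k;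
  amul : alg_mod -> alg_mod -> alg_mod;
  aone : alg_mod;
  amulA : associative amul;
  amul1l : left_id aone amul;
  amul1r : right_id aone amul;
  amul_bilin : bilin amul
}.

Definition alg_sort (k : comPzRingType) (A : algebra k) : Type := alg_mod A.
Coercion alg_sort : algebra >-> Sortclass.

Section AlgebraInstances.
Context {k : comPzRingType} (A : algebra k).

HB.instance Definition _ := GRing.Lmodule.copy (alg_sort A) (alg_mod A).

Lemma amulDl : left_distributive (@amul k A) +%R.
Proof. by move=> x y z; rewrite (bilinDl (amul_bilin A)). Qed.
Lemma amulDr : right_distributive (@amul k A) +%R.
Proof. by move=> x y z; rewrite (bilinDr (amul_bilin A)). Qed.

HB.instance Definition _ := GRing.Zmodule_isPzRing.Build (alg_sort A)
  (@amulA k A) (@amul1l k A) (@amul1r k A) amulDl amulDr.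

Lemma mul_bilin : bilin (fun x y : A => x * y).
Proof. exact: amul_bilin. Qed.

End AlgebraInstances.

(* Hom-sets carry Leibniz equality. *)
Record is_category (ob : Type) (mor : ob -> ob -> Type) := IsCategory {
  mor_id : forall x, mor x x;
  mor_comp : forall x y z, mor y z -> mor x y -> mor x z;
  mor_compA : forall x y z w (h : mor z w) (g : mor y z) (f : mor x y),
    mor_comp h (mor_comp g f) = mor_comp (mor_comp h g) f;
  mor_comp1l : forall x y (f : mor x y), mor_comp (mor_id y) f = f;
  mor_comp1r : forall x y (f : mor x y), mor_comp f (mor_id x) = f
}.

Record category := Category {
  ob :> Type;
  mor : ob -> ob -> Type;
  category_struct :> is_category mor
}.

Notation "g \oc f" := (mor_comp (category_struct _) g f)
  (at level 50, left associativity).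
Notation idc x := (mor_id (category_struct _) x).

Record functor (C D : category) := Functor {
  fob :> C -> D;
  fmap : forall x y : C, mor x y -> mor (fob x) (fob y);
  fmap_id : forall x, fmap (idc x) = idc (fob x);
  fmap_comp : forall (x y z : C) (g : mor y z) (f : mor x y),
    fmap (g \oc f) = fmap g \oc fmap f
}.

(* L is left adjoint to R. *)
Record adjunction (C D : category) (L : functor C D) (R : functor D C) :=
  Adjunction {
  adj : forall (x : C) (y : D), mor (L x) y -> mor x (R y);
  adjV : forall (x : C) (y : D), mor x (R y) -> mor (L x) y;
  adjK : forall (x : C) (y : D), cancel (@adj x y) (@adjV x y);
  adjVK : forall (x : C) (y : D), cancel (@adjV x y) (@adj x y);
  adj_nat : forall (x x' : C) (y y' : D) (f : mor x' x) (g : mor y y')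
    (h : mor (L x) y),
    adj (g \oc h \oc fmap L f) = fmap R g \oc adj h \oc f
}.

(* Functors C^op x C -> Set. *)
Record profunctor (C : category) := Profunctor {
  pob :> C -> C -> Type;
  pmap : forall x x' y y' : C, mor x' x -> mor y y' -> pob x y -> pob x' y';
  pmap_id : forall (x y : C) (u : pob x y), pmap (idc x) (idc y) u = u;
  pmap_comp : forall (x x' x'' y y' y'' : C) (f : mor x' x) (f' : mor x'' x')
    (g : mor y y') (g' : mor y' y'') (u : pob x y),
    pmap (f \oc f') (g' \oc g) u = pmap f' g' (pmap f g u)
}.

(* Bijections P x y -> Q x y natural in x and y. *)
Definition natural_bijection (C : category) (P Q : profunctor C)
    (alpha : forall x y : C, P x y -> Q x y) : Prop :=
  (forall x y, bijective (alpha x y)) /\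
  (forall (x x' y y' : C) (f : mor x' x) (g : mor y y') (u : P x y),
    alpha x' y' (pmap f g u) = pmap f g (alpha x y u)).

Section HomFrom.
Context {C : category} (L : functor C C).

Definition hom_from_map (x x' y y' : C) (f : mor x' x) (g : mor y y')
  (h : mor (L x) y) : mor (L x') y' := g \oc h \oc fmap L f.

Lemma hom_from_id (x y : C) (h : mor (L x) y) :
  hom_from_map (idc x) (idc y) h = h.
Proof. by rewrite /hom_from_map fmap_id mor_comp1r mor_comp1l. Qed.

Lemma hom_from_comp (x x' x'' y y' y'' : C) (f : mor x' x) (f' : mor x'' x')
    (g : mor y y') (g' : mor y' y'') (h : mor (L x) y) :
  hom_from_map (f \oc f') (g' \oc g) h =
  hom_from_map f' g' (hom_from_map f g h).
Proof. by rewrite /hom_from_map fmap_comp !mor_compA. Qed.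

Definition hom_from : profunctor C := Profunctor hom_from_id hom_from_comp.

End HomFrom.

Section Modules.
Variable k : comPzRingType.

Record rmodule := RModule {
  rm_alg : algebra k;
  rm_mod :> lmodType k;
  ract : rm_mod -> rm_alg -> rm_mod;
  ract_bilin : bilin ract;
  ract1 : forall x, ract x 1 = x;
  ractM : forall x a b, ract x (a * b) = ract (ract x a) b
}.

Record rmod_hom (M N : rmodule) := RModHom {
  rmh_alg : {linear rm_alg M -> rm_alg N};
  rmh_mod : {linear M -> N};
  rmh_algM : monoid_morphism rmh_alg;
  rmh_act : forall x a, rmh_mod (ract x a) = ract (rmh_mod x) (rmh_alg a)
}.

Lemma rmod_hom_ext (M N : rmodule) (f g : rmod_hom M N) :
  rmh_alg f =1 rmh_alg g -> rmh_mod f =1 rmh_mod g -> f = g.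
Proof.
case: f g => [f p mf af] [g q mg ag] /= /lin_ext fg /lin_ext pq; subst.
by rewrite (Prop_irrelevance mf mg) (Prop_irrelevance af ag).
Qed.

Lemma lid_monoid (A : algebra k) : monoid_morphism (lid A).
Proof. by []. Qed.

Lemma lcomp_monoid (A B C : algebra k) (g : {linear B -> C})
    (f : {linear A -> B}) :
  monoid_morphism g -> monoid_morphism f -> monoid_morphism (lcomp g f).
Proof.
by move=> [g1 gM] [f1 fM]; split=> [|x y]; rewrite !lcompE ?f1 ?g1 ?fM ?gM.
Qed.

Definition rmod_id (M : rmodule) : rmod_hom M M :=
  @RModHom M M (lid _) (lid _) (lid_monoid _) (fun _ _ => erefl).

Lemma rmod_comp_act (M N P : rmodule) (g : rmod_hom N P) (f : rmod_hom M N) x a :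
  lcomp (rmh_mod g) (rmh_mod f) (ract x a) =
  ract (lcomp (rmh_mod g) (rmh_mod f) x) (lcomp (rmh_alg g) (rmh_alg f) a).
Proof. by rewrite !lcompE !rmh_act. Qed.

Definition rmod_comp (M N P : rmodule) (g : rmod_hom N P) (f : rmod_hom M N) :
    rmod_hom M P :=
  RModHom (lcomp_monoid (rmh_algM g) (rmh_algM f)) (rmod_comp_act g f).

Lemma rmod_compA M N P Q (h : rmod_hom P Q) (g : rmod_hom N P) (f : rmod_hom M N) :
  rmod_comp h (rmod_comp g f) = rmod_comp (rmod_comp h g) f.
Proof. exact: rmod_hom_ext. Qed.
Lemma rmod_comp1l M N (f : rmod_hom M N) : rmod_comp (rmod_id N) f = f.
Proof. exact: rmod_hom_ext. Qed.
Lemma rmod_comp1r M N (f : rmod_hom M N) : rmod_comp f (rmod_id M) = f.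
Proof. exact: rmod_hom_ext. Qed.

Definition rmod_is_category : is_category rmod_hom :=
  IsCategory rmod_compA rmod_comp1l rmod_comp1r.

Definition Mod : category := Category rmod_is_category.

End Modules.

Section Comodules.
Variable k : comPzRingType.

Record coalgebra := Coalgebra {
  coalg_mod :> lmodType k;
  comul : {linear coalg_mod -> coalg_mod ⊗ coalg_mod};
  counit : {linear coalg_mod -> k^o};
  coassoc : forall c, tassoc (tmap comul (lid _) (comul c)) =
                      tmap (lid _) comul (comul c);
  counitl : forall c, \tsum_(x, y <- comul c) (counit x *: y) = c;
  counitr : forall c, \tsum_(x, y <- comul c) (counit y *: x) = c
}.

Record comodule := Comodule {
  com_coalg : coalgebra;
  com_mod :> lmodType k;
  coact : {linear com_mod -> com_mod ⊗ com_coalg};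
  coact_coassoc : forall x, tassoc (tmap coact (lid _) (coact x)) =
                            tmap (lid _) (comul com_coalg) (coact x);
  coact_counit : forall x,
    \tsum_(y, c <- coact x) (counit com_coalg c *: y) = x
}.

Record comod_hom (X Y : comodule) := ComodHom {
  cmh_coalg : {linear com_coalg X -> com_coalg Y};
  cmh_mod : {linear X -> Y};
  cmh_comul : forall c,
    comul _ (cmh_coalg c) = tmap cmh_coalg cmh_coalg (comul _ c);
  cmh_counit : forall c, counit _ (cmh_coalg c) = counit _ c;
  cmh_coact : forall x,
    coact Y (cmh_mod x) = tmap cmh_mod cmh_coalg (coact X x)
}.

Lemma comod_hom_ext (X Y : comodule) (f g : comod_hom X Y) :
  cmh_coalg f =1 cmh_coalg g -> cmh_mod f =1 cmh_mod g -> f = g.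
Proof.
case: f g => [f p a b c] [g q a' b' c'] /= /lin_ext fg /lin_ext pq; subst.
rewrite (Prop_irrelevance a a') (Prop_irrelevance b b').
by rewrite (Prop_irrelevance c c').
Qed.

Lemma comod_id_subproof (U V : lmodType k) (t : U ⊗ V) :
  t = tmap (lid _) (lid _) t.
Proof. by rewrite tmap_id. Qed.

Definition comod_id (X : comodule) : comod_hom X X :=
  @ComodHom X X (lid _) (lid _) (fun=> comod_id_subproof _) (fun=> erefl)
    (fun=> comod_id_subproof _).

Section Comp.
Context {X Y Z : comodule} (g : comod_hom Y Z) (f : comod_hom X Y).
Let h := lcomp (cmh_coalg g) (cmh_coalg f).
Let p := lcomp (cmh_mod g) (cmh_mod f).

Lemma comod_comp_comul c : comul _ (h c) = tmap h h (comul _ c).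
Proof. by rewrite lcompE !cmh_comul tmap_compE. Qed.
Lemma comod_comp_counit c : counit _ (h c) = counit _ c.
Proof. by rewrite lcompE !cmh_counit. Qed.
Lemma comod_comp_coact x : coact _ (p x) = tmap p h (coact _ x).
Proof. by rewrite lcompE !cmh_coact tmap_compE. Qed.

Definition comod_comp : comod_hom X Z :=
  ComodHom comod_comp_comul comod_comp_counit comod_comp_coact.
End Comp.

Lemma comod_compA M N P Q (h : comod_hom P Q) (g : comod_hom N P) (f : comod_hom M N) :
  comod_comp h (comod_comp g f) = comod_comp (comod_comp h g) f.
Proof. exact: comod_hom_ext. Qed.
Lemma comod_comp1l M N (f : comod_hom M N) : comod_comp (comod_id N) f = f.
Proof. exact: comod_hom_ext. Qed.
Lemma comod_comp1r M N (f : comod_hom M N) : comod_comp f (comod_id M) = f.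
Proof. exact: comod_hom_ext. Qed.

Definition comod_is_category : is_category comod_hom :=
  IsCategory comod_compA comod_comp1l comod_comp1r.

Definition Comod : category := Category comod_is_category.

Definition comod_self (C : coalgebra) : comodule :=
  @Comodule C C (comul C) (@coassoc C) (@counitr C).

End Comodules.

Section Convolution.
Variable k : comPzRingType.

Lemma coact_trilin (X : comodule k) (V : lmodType k)
    (f : X -> com_coalg X -> com_coalg X -> V) x : trilin f ->
  \tsum_(w, c <- coact X x) (\tsum_(y, b <- coact X w) f y b c) =
  \tsum_(y, w <- coact X x) (\tsum_(b, c <- comul _ w) f y b c).
Proof.
move=> tf.
rewrite -(tsum_tmap (coact X) (lid _) _ (trilinl tf)) tsum_tassoc //.
by rewrite coact_coassoc (tsum_tmap _ _ _ (trilinr tf)).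
Qed.

Lemma linD (U V : lmodType k) (f g : {linear U -> V}) x : (f + g) x = f x + g x.
Proof. by []. Qed.
Lemma linZ (U V : lmodType k) (a : k) (f : {linear U -> V}) x :
  (a *: f) x = a *: f x.
Proof. by []. Qed.

Lemma bilin_lin2 (U U' V V' W : lmodType k) (op : U' -> V' -> W)
    (f : {linear U -> U'}) (g : {linear V -> V'}) :
  bilin op -> bilin (fun x y => op (f x) (g y)).
Proof. exact: bilin_comp f g (lid W). Qed.

Lemma conv_bilin (U V U' V' W : lmodType k) (op : U' -> V' -> W)
    (t : U ⊗ V) : bilin op ->
  bilin (fun (f : {linear U -> U'}) (g : {linear V -> V'}) =>
    \tsum_(x, y <- t) op (f x) (g y)).
Proof.
move=> bop; split=> [g a f f'|f a g g']; rewrite /tsum scaler_sumr -big_split;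
  apply: eq_bigr => p _.
  by rewrite -[LHS]/(op ((a *: f + f') p.1) (g p.2)) linD linZ (bilinDl bop) (bilinZl bop).
by rewrite -[LHS]/(op (f p.1) ((a *: g + g') p.2)) linD linZ (bilinDr bop) (bilinZr bop).
Qed.

Section ConvAlgebra.
Variables (C : coalgebra k) (B : algebra k).

Definition conv_mul (f g : {linear C -> B}) : {linear C -> B} :=
  lcomp (tlift (bilin_lin2 f g (mul_bilin B))) (comul C).

Lemma conv_mulE f g c :
  conv_mul f g c = \tsum_(x, y <- comul C c) (f x * g y).
Proof. by []. Qed.

Lemma conv_one_linear : linear (fun c : C => counit C c *: (1 : B)).
Proof. by move=> a x y; rewrite linearP scalerDl scalerA. Qed.
Definition conv_one : {linear C -> B} := mklin conv_one_linear.

Lemma conv_mulA : associative conv_mul.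
Proof.
move=> f g h; apply: lin_ext => c; rewrite !conv_mulE.
pose F (x y z : C) : B := f x * g y * h z.
have tF : trilin F.
  by split=> *; move=> a u v; rewrite /F linearP;
     rewrite ?mulrDl ?mulrDr ?mulrDl; congr (_ + _);
     rewrite ?(bilinZl (mul_bilin B)) ?(bilinZr (mul_bilin B))
       ?(bilinZl (mul_bilin B)).
have := @coact_trilin (comod_self C) B F c tF => /= H.
transitivity (\tsum_(y, w <- comul C c) \tsum_(b, c0 <- comul C w) F y b c0).
  apply: eq_tsum => x y; rewrite -[LHS]/(f x * conv_mul g h y) conv_mulE.
  rewrite /tsum mulr_sumr.
  by apply: eq_bigr => p _; rewrite /F mulrA.
rewrite -{}H; apply: eq_tsum => x y.
rewrite -[RHS]/(conv_mul f g x * h y) conv_mulE /tsum mulr_suml.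
by apply: eq_bigr => p _.
Qed.

Lemma conv_mul1l : left_id conv_one conv_mul.
Proof.
move=> f; apply: lin_ext => c; rewrite conv_mulE -[c in RHS](counitl c) lin_tsum.
apply: eq_tsum => x y; rewrite linearZ /=.
by rewrite -[LHS]/((counit C x *: (1 : B) : B) * f y) (bilinZl (mul_bilin B)) mul1r.
Qed.

Lemma conv_mul1r : right_id conv_one conv_mul.
Proof.
move=> f; apply: lin_ext => c; rewrite conv_mulE -[c in RHS](counitr c) lin_tsum.
apply: eq_tsum => x y; rewrite linearZ /=.
by rewrite -[LHS]/(f x * (counit C y *: (1 : B) : B)) (bilinZr (mul_bilin B)) mulr1.
Qed.

Lemma conv_mul_bilin : bilin conv_mul.
Proof.
split=> [g a f f'|f a g g']; apply: lin_ext => c.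
  exact: (conv_bilin (comul C c) (mul_bilin B)).1.
exact: (conv_bilin (comul C c) (mul_bilin B)).2.
Qed.

Definition conv : algebra k :=
  Algebra conv_mulA conv_mul1l conv_mul1r conv_mul_bilin.

End ConvAlgebra.

Section ConvModule.
Variables (X : comodule k) (N : rmodule k).
Let C := com_coalg X.
Let B := rm_alg N.

Definition conv_act (h : {linear X -> N}) (f : conv C B) : {linear X -> N} :=
  lcomp (tlift (bilin_lin2 h f (ract_bilin N))) (coact X).

Lemma conv_actE h f x :
  conv_act h f x =
  \tsum_(y, c <- coact X x) ract (h y) ((f : {linear C -> B}) c).
Proof. by []. Qed.

Lemma conv_act_bilin : bilin conv_act.
Proof.
split=> [g a f f'|f a g g']; apply: lin_ext => c.
  exact: (conv_bilin (coact X c) (ract_bilin N)).1.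
exact: (conv_bilin (coact X c) (ract_bilin N)).2.
Qed.

Lemma conv_act1 h : conv_act h 1 = h.
Proof.
apply: lin_ext => x; rewrite conv_actE -[x in RHS](coact_counit x) lin_tsum.
apply: eq_tsum => y c; rewrite linearZ /=.
rewrite -[LHS]/(ract (h y) (counit C c *: (1 : B))) (bilinZr (ract_bilin N)).
by rewrite ract1.
Qed.

Lemma conv_actM h f g : conv_act h (f * g) = conv_act (conv_act h f) g.
Proof.
apply: lin_ext => x; rewrite !conv_actE.
pose F (y : X) (b c : C) : N :=
  ract (ract (h y) ((f : {linear C -> B}) b)) ((g : {linear C -> B}) c).
have bN := ract_bilin N.
have tF : trilin F.
  by split=> *; move=> a u v; rewrite /F linearP;
     rewrite ?(bilinDl bN, bilinDr bN, bilinZl bN, bilinZr bN).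
transitivity (\tsum_(y, w <- coact X x) \tsum_(b, c <- comul C w) F y b c).
  apply: eq_tsum => y c.
  rewrite -[(f * g : conv C B) c]/(conv_mul f g c) conv_mulE.
  rewrite -[ract _ _]/(mklin (bN.2 (h y)) _) lin_tsum.
  by apply: eq_tsum => b d; rewrite -[mklin _ _]/(ract _ _) ractM.
rewrite -coact_trilin //; apply: eq_tsum => y c.
rewrite conv_actE -[ract _ _]/(mklin (bN.1 _) _) lin_tsum.
by apply: eq_tsum.
Qed.

Definition conv_module : rmodule k :=
  RModule conv_act_bilin conv_act1 conv_actM.

End ConvModule.

Section ConvFunctor.
Variable X : comodule k.
Let C := com_coalg X.

Section Map.
Context {N P : rmodule k} (f : rmod_hom N P).

Lemma conv_map_alg_linear :
  linear (fun h : {linear C -> rm_alg N} => lcomp (rmh_alg f) h).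
Proof. by move=> a g h; apply: lin_ext => c; rewrite lcompE /= linearP. Qed.
Lemma conv_map_mod_linear :
  linear (fun h : {linear X -> N} => lcomp (rmh_mod f) h).
Proof. by move=> a g h; apply: lin_ext => c; rewrite lcompE /= linearP. Qed.

Definition conv_map_alg : {linear conv C (rm_alg N) -> conv C (rm_alg P)} :=
  mklin conv_map_alg_linear.
Definition conv_map_mod : {linear conv_module X N -> conv_module X P} :=
  mklin conv_map_mod_linear.

Lemma conv_map_alg_monoid : monoid_morphism conv_map_alg.
Proof.
have [f1 fM] := rmh_algM f; split=> [|g h]; apply: lin_ext => c.
  rewrite -[LHS]/(rmh_alg f (counit C c *: (1 : rm_alg N))).
  by rewrite linearZ /= f1.
rewrite -[LHS]/(rmh_alg f (conv_mul g h c)).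
rewrite -[RHS]/(conv_mul (conv_map_alg g) (conv_map_alg h) c).
by rewrite !conv_mulE lin_tsum; apply: eq_tsum => x y; apply: fM.
Qed.

Lemma conv_map_act h g :
  conv_map_mod (ract h g) = ract (conv_map_mod h) (conv_map_alg g).
Proof.
apply: lin_ext => x.
rewrite -[LHS]/(rmh_mod f (conv_act h g x)).
rewrite -[RHS]/(conv_act (conv_map_mod h) (conv_map_alg g) x).
by rewrite !conv_actE lin_tsum; apply: eq_tsum => y c; apply: rmh_act.
Qed.

Definition conv_map : rmod_hom (conv_module X N) (conv_module X P) :=
  @RModHom k (conv_module X N) (conv_module X P) conv_map_alg conv_map_mod
    conv_map_alg_monoid conv_map_act.
End Map.

Lemma conv_map_id (N : rmodule k) :
  conv_map (rmod_id N) = rmod_id (conv_module X N).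
Proof. by apply: rmod_hom_ext => h; apply: lin_ext. Qed.

Lemma conv_map_comp (N P Q : rmodule k) (g : rmod_hom P Q) (f : rmod_hom N P) :
  conv_map (rmod_comp g f) = rmod_comp (conv_map g) (conv_map f).
Proof. by apply: rmod_hom_ext => h; apply: lin_ext. Qed.

Definition conv_functor : functor (Mod k) (Mod k) :=
  @Functor (Mod k) (Mod k) (conv_module X) (@conv_map) conv_map_id conv_map_comp.

End ConvFunctor.
End Convolution.

Section Measurings.
Variable k : comPzRingType.

Record measuring (M : rmodule k) (X : comodule k) (N : rmodule k) := Measuring {
  meas_alg : {linear rm_alg M ⊗ com_coalg X -> rm_alg N};
  meas_mod : {linear M ⊗ X -> N};
  meas_algM : forall (a a' : rm_alg M) c, meas_alg ((a * a') ⊗t c) =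
    \tsum_(c1, c2 <- comul _ c) (meas_alg (a ⊗t c1) * meas_alg (a' ⊗t c2));
  meas_alg1 : forall c, meas_alg ((1 : rm_alg M) ⊗t c) = counit _ c *: (1 : rm_alg N);
  meas_act : forall u a x, meas_mod (ract u a ⊗t x) =
    \tsum_(x0, x1 <- coact X x) ract (meas_mod (u ⊗t x0)) (meas_alg (a ⊗t x1))
}.

Lemma measuring_ext (M : rmodule k) (X : comodule k) (N : rmodule k)
    (f g : measuring M X N) :
  (forall a c, meas_alg f (a ⊗t c) = meas_alg g (a ⊗t c)) ->
  (forall u x, meas_mod f (u ⊗t x) = meas_mod g (u ⊗t x)) -> f = g.
Proof.
case: f g => [f p a b c] [g q a' b' c'] /= /tensor_ext fg /tensor_ext pq; subst.
rewrite (Prop_irrelevance a a') (Prop_irrelevance b b').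
by rewrite (Prop_irrelevance c c').
Qed.

Section Map.
Context {M M' N N' : rmodule k} {X X' : comodule k}.
Variables (f : rmod_hom M' M) (h : comod_hom X' X) (g : rmod_hom N N').
Variable u : measuring M X N.

Let phi := lcomp (rmh_alg g) (lcomp (meas_alg u) (tmap (rmh_alg f) (cmh_coalg h))).
Let psi := lcomp (rmh_mod g) (lcomp (meas_mod u) (tmap (rmh_mod f) (cmh_mod h))).

Lemma meas_map_algE a c :
  phi (a ⊗t c) = rmh_alg g (meas_alg u (rmh_alg f a ⊗t cmh_coalg h c)).
Proof. by rewrite /phi !lcompE tmap_tens. Qed.

Lemma meas_map_modE v x :
  psi (v ⊗t x) = rmh_mod g (meas_mod u (rmh_mod f v ⊗t cmh_mod h x)).
Proof. by rewrite /psi !lcompE tmap_tens. Qed.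

Lemma tens_linr (U V : lmodType k) (x : U) : linear (fun y : V => x ⊗t y).
Proof. exact: (tens_bilin.2 x). Qed.

Lemma meas_map_algM (a a' : rm_alg M') c : phi ((a * a') ⊗t c) =
  \tsum_(c1, c2 <- comul _ c) (phi (a ⊗t c1) * phi (a' ⊗t c2)).
Proof.
have [g1 gM] := rmh_algM g; have [f1 fM] := rmh_algM f.
rewrite meas_map_algE fM meas_algM cmh_comul lin_tsum.
pose l b := lcomp (meas_alg u) (mklin (@tens_linr _ (com_coalg X) b)).
rewrite tsum_tmap.
  by apply: eq_tsum => c1 c2; rewrite gM !meas_map_algE.
exact: (bilin_comp (l (rmh_alg f a)) (l (rmh_alg f a')) (rmh_alg g)
  (mul_bilin _)).
Qed.

Lemma meas_map_alg1 c : phi ((1 : rm_alg M') ⊗t c) = counit _ c *: (1 : rm_alg N').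
Proof.
have [g1 gM] := rmh_algM g; have [f1 fM] := rmh_algM f.
by rewrite meas_map_algE f1 meas_alg1 cmh_counit linearZ /= g1.
Qed.

Lemma meas_map_act v a x : psi (ract v a ⊗t x) =
  \tsum_(x0, x1 <- coact X' x) ract (psi (v ⊗t x0)) (phi (a ⊗t x1)).
Proof.
rewrite meas_map_modE rmh_act meas_act cmh_coact lin_tsum.
pose l := lcomp (meas_mod u) (mklin (@tens_linr _ X (rmh_mod f v))).
pose l' := lcomp (meas_alg u) (mklin (@tens_linr _ (com_coalg X) (rmh_alg f a))).
rewrite tsum_tmap.
  by apply: eq_tsum => c1 c2; rewrite rmh_act meas_map_modE meas_map_algE.
exact: (bilin_comp l l' (rmh_mod g) (ract_bilin _)).
Qed.

Definition meas_map : measuring M' X' N' :=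
  Measuring meas_map_algM meas_map_alg1 meas_map_act.

End Map.

Lemma meas_map_id (M N : rmodule k) (X : comodule k) (u : measuring M X N) :
  meas_map (rmod_id M) (comod_id X) (rmod_id N) u = u.
Proof.
by apply: measuring_ext => *; rewrite ?meas_map_algE ?meas_map_modE.
Qed.

Lemma meas_map_comp (M M' M'' N N' N'' : rmodule k) (X X' X'' : comodule k)
    (f : rmod_hom M' M) (f' : rmod_hom M'' M') (h : comod_hom X' X)
    (h' : comod_hom X'' X') (g : rmod_hom N N') (g' : rmod_hom N' N'')
    (u : measuring M X N) :
  meas_map (rmod_comp f f') (comod_comp h h') (rmod_comp g' g) u =
  meas_map f' h' g' (meas_map f h g u).
Proof.
by apply: measuring_ext => *; rewrite ?meas_map_algE ?meas_map_modE.
Qed.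

Section MeasProfunctor.
Variable X : comodule k.

Definition Meas_map (M M' N N' : Mod k) (f : mor M' M) (g : mor N N')
  (u : measuring M X N) : measuring M' X N' := meas_map f (comod_id X) g u.

Lemma Meas_map_id (M N : Mod k) (u : measuring M X N) :
  Meas_map (idc M) (idc N) u = u.
Proof. exact: meas_map_id. Qed.

Lemma Meas_map_comp (M M' M'' N N' N'' : Mod k) (f : mor M' M)
    (f' : mor M'' M') (g : mor N N') (g' : mor N' N'') (u : measuring M X N) :
  Meas_map (f \oc f') (g' \oc g) u = Meas_map f' g' (Meas_map f g u).
Proof. by rewrite /Meas_map -meas_map_comp comod_comp1l. Qed.

Definition Meas : profunctor (Mod k) := Profunctor Meas_map_id Meas_map_comp.

End MeasProfunctor.

(* A universal measuring comodule: an object of Comod representing             *)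
(* X |-> Meas(M, X, N).                                                        *)
Record universal_comodule (M N : rmodule k) := UniversalComodule {
  univ_com :> comodule k;
  univ_meas : forall X : Comod k, mor X (univ_com : Comod k) -> measuring M X N;
  univ_hom : forall X : Comod k, measuring M X N -> mor X (univ_com : Comod k);
  univ_measK : forall X, cancel (@univ_meas X) (@univ_hom X);
  univ_homK : forall X, cancel (@univ_hom X) (@univ_meas X);
  univ_nat : forall (X Y : Comod k) (h : mor X Y) (t : mor Y (univ_com : Comod k)),
    univ_meas (t \oc h) = meas_map (rmod_id M) h (rmod_id N) (univ_meas t)
}.

Section UnivProfunctor.
Variable Q : forall M N : rmodule k, universal_comodule M N.

(* The functoriality of Q(M, N) in M and N, forced by the universal property.  *)
Definition univ_map (M M' N N' : Mod k) (f : mor M' M) (g : mor N N') :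
    mor (Q M N : Comod k) (Q M' N') :=
  univ_hom (Q M' N')
    (meas_map f (comod_id (Q M N)) g (univ_meas (idc (Q M N : Comod k)))).

Lemma univ_meas_map (X : Comod k) (M M' N N' : Mod k) (f : mor M' M)
    (g : mor N N') (t : mor X (Q M N)) :
  univ_meas (univ_map f g \oc t) = meas_map f (comod_id X) g (univ_meas t).
Proof.
rewrite univ_nat univ_homK -meas_map_comp.
rewrite -[t in RHS](@mor_comp1l _ _ (Comod k)) univ_nat -meas_map_comp.
by rewrite !rmod_comp1l !rmod_comp1r comod_comp1l comod_comp1r.
Qed.

Lemma univ_meas_inj (M N : rmodule k) (X : Comod k) :
  injective (@univ_meas M N (Q M N) X).
Proof. exact: can_inj (@univ_measK _ _ _ _). Qed.

Variable X : comodule k.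

Definition Comod_map (M M' N N' : Mod k) (f : mor M' M) (g : mor N N')
    (t : mor (X : Comod k) (Q M N)) : mor (X : Comod k) (Q M' N') :=
  univ_map f g \oc t.

Lemma Comod_map_id (M N : Mod k) (t : mor (X : Comod k) (Q M N)) :
  Comod_map (idc M) (idc N) t = t.
Proof. by apply: univ_meas_inj; rewrite univ_meas_map meas_map_id. Qed.

Lemma Comod_map_comp (M M' M'' N N' N'' : Mod k) (f : mor M' M)
    (f' : mor M'' M') (g : mor N N') (g' : mor N' N'')
    (t : mor (X : Comod k) (Q M N)) :
  Comod_map (f \oc f') (g' \oc g) t = Comod_map f' g' (Comod_map f g t).
Proof.
by apply: univ_meas_inj; rewrite !univ_meas_map -meas_map_comp comod_comp1l.
Qed.

Definition Comod_into : profunctor (Mod k) :=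
  Profunctor Comod_map_id Comod_map_comp.

End UnivProfunctor.

End Measurings.

(* A length is an element of N or +oo (None); didx m is the set of indices     *)
(* i <= m.                                                                     *)
Definition le_len (i : nat) (m : option nat) : bool :=
  if m is Some m' then (i <= m')%N else true.

Definition didx (m : option nat) : Type := {i : nat | le_len i m}.

Section Indices.
Variable m : option nat.

HB.instance Definition _ := SubType.on (didx m).
HB.instance Definition _ := Equality.on (didx m).

Lemma le_len0 : le_len 0 m. Proof. by case: m. Qed.

Lemma le_lenW i j : (i <= j)%N -> le_len j m -> le_len i m.
Proof. by case: m => //= m' ij; apply: leq_trans. Qed.

Definition didx0 : didx m := exist _ 0%N le_len0.

Lemma lidx_subproof (n : didx m) (i : 'I_(val n).+1) : le_len i m.
Proof. by apply: le_lenW (valP n); rewrite -ltnS. Qed.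
Lemma ridx_subproof (n : didx m) (i : 'I_(val n).+1) : le_len (val n - i) m.
Proof. by apply: le_lenW (valP n); apply: leq_subr. Qed.

Definition lidx (n : didx m) (i : 'I_(val n).+1) : didx m :=
  exist _ (i : nat) (lidx_subproof i).
Definition ridx (n : didx m) (i : 'I_(val n).+1) : didx m :=
  exist _ (val n - i)%N (ridx_subproof i).

End Indices.

Arguments didx0 {m}.

(* The sum of E over the pairs of indices (i, j) such that i + j = n.           *)
Notation "\dsum_ ( i + j == n ) E" :=
  (\sum_(r < (val n).+1) (fun i j => E) (lidx r) (ridx r))
  (at level 41, i name, j name, n at level 50, E at level 41,
   format "\dsum_ ( i  +  j  ==  n )  E") : ring_scope.

Section Derivations.
Variables (k : comPzRingType) (m : option nat).

Record higher_derivation (A B : algebra k) := HigherDerivation {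
  hder :> didx m -> {linear A -> B};
  hder0 : monoid_morphism (hder didx0);
  hderM : forall n x y,
    hder n (x * y) = \dsum_(i + j == n) (hder i x * hder j y)
}.

Record module_derivation (M N : rmodule k) := ModuleDerivation {
  mder_alg : higher_derivation (rm_alg M) (rm_alg N);
  mder_mod : didx m -> {linear M -> N};
  mder_act : forall n x a, mder_mod n (ract x a) =
    \dsum_(i + j == n) ract (mder_mod i x) (mder_alg j a)
}.

Lemma module_derivation_ext (M N : rmodule k) (D E : module_derivation M N) :
  (forall n, mder_alg D n =1 mder_alg E n) ->
  (forall n, mder_mod D n =1 mder_mod E n) -> D = E.
Proof.
case: D E => [[D D0 DM] d dM] [[E E0 EM] e eM] /= DE de.
have {}DE : D = E by apply/funext => n; apply: lin_ext.
have {}de : d = e by apply/funext => n; apply: lin_ext.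
subst E e; move: eM; rewrite (Prop_irrelevance E0 D0) (Prop_irrelevance EM DM).
by move=> eM; rewrite (Prop_irrelevance eM dM).
Qed.

Section Map.
Context {M M' N N' : rmodule k} (f : rmod_hom M' M) (g : rmod_hom N N').
Variable D : module_derivation M N.

Let D' n := lcomp (rmh_alg g) (lcomp (mder_alg D n) (rmh_alg f)).
Let d' n := lcomp (rmh_mod g) (lcomp (mder_mod D n) (rmh_mod f)).

Lemma mder_map_alg0 : monoid_morphism (D' didx0).
Proof.
apply: lcomp_monoid (rmh_algM g) _.
exact: lcomp_monoid (hder0 _) (rmh_algM f).
Qed.

Lemma mder_map_algM n x y :
  D' n (x * y) = \dsum_(i + j == n) (D' i x * D' j y).
Proof.
have [_ gM] := rmh_algM g; have [_ fM] := rmh_algM f.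
rewrite !lcompE fM hderM linear_sum; apply: eq_bigr => i _.
by rewrite !lcompE gM.
Qed.

Lemma mder_map_act n x a :
  d' n (ract x a) = \dsum_(i + j == n) ract (d' i x) (D' j a).
Proof.
rewrite !lcompE rmh_act mder_act linear_sum; apply: eq_bigr => i _.
by rewrite !lcompE rmh_act.
Qed.

Definition mder_map : module_derivation M' N' :=
  @ModuleDerivation M' N' (HigherDerivation mder_map_alg0 mder_map_algM) d'
    mder_map_act.

End Map.

Definition MDer_map (M M' N N' : Mod k) (f : mor M' M) (g : mor N N') :
  module_derivation M N -> module_derivation M' N' := mder_map f g.

Lemma MDer_map_id (M N : Mod k) (D : module_derivation M N) :
  MDer_map (idc M) (idc N) D = D.
Proof. exact: module_derivation_ext. Qed.

Lemma MDer_map_comp (M M' M'' N N' N'' : Mod k) (f : mor M' M)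
    (f' : mor M'' M') (g : mor N N') (g' : mor N' N'')
    (D : module_derivation M N) :
  MDer_map (f \oc f') (g' \oc g) D = MDer_map f' g' (MDer_map f g D).
Proof. exact: module_derivation_ext. Qed.

Definition MDer : profunctor (Mod k) := Profunctor MDer_map_id MDer_map_comp.

End Derivations.

Section FreeModule.
Variables (k : comPzRingType) (m : option nat).

(* The free module on {v_i : i <= m}, as finitely supported functions.         *)
Definition fin_supp : {pred didx m -> k^o} :=
  fun f => `[< exists b, forall n, (b <= val n)%N -> f n = 0 >].

Lemma fin_supp_closed : GRing.subsemimod_closed fin_supp.
Proof.
split; first split.
- by apply/asboolP; exists 0%N.
- move=> f g /asboolP[b fb] /asboolP[c gc]; apply/asboolP; exists (maxn b c).
  by move=> n; rewrite geq_max => /andP[bn cn]; rewrite /= fctE fb // gc // addr0.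
- move=> a f /asboolP[b fb]; apply/asboolP; exists b => n bn.
  by rewrite -[LHS]/(a *: f n) fb // scaler0.
Qed.
HB.instance Definition _ :=
  GRing.isSubSemiModClosed.Build k (didx m -> k^o) fin_supp fin_supp_closed.

Record cm := MkCm { cm_coef :> didx m -> k^o; _ : cm_coef \in fin_supp }.
HB.instance Definition _ := [isSub for cm_coef].
HB.instance Definition _ := [Choice of cm by <:].
HB.instance Definition _ := [SubChoice_isSubLmodule of cm by <:].

Lemma cmP (f : cm) : exists b, forall n, (b <= val n)%N -> f n = 0.
Proof. exact/asboolP/(valP f). Qed.

Lemma cm_v_subproof (n : didx m) :
  (fun i => (i == n)%:R : k^o) \in fin_supp.
Proof.
apply/asboolP; exists (val n).+1 => i; case: eqP => // ->.
by rewrite ltnn.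
Qed.
Definition cm_v (n : didx m) : cm := MkCm (cm_v_subproof n).

Definition cm_bound (f : cm) : nat := projT1 (cid (cmP f)).

Section Lift.
Variables (V : lmodType k) (g : didx m -> V).

(* The linear map sending v_i to g i.                                          *)
Definition cm_lift_fun (f : cm) : V :=
  \sum_(i < cm_bound f) oapp (fun n : didx m => (f n : k) *: g n) 0 (insub (i : nat)).

Lemma cm_lift_bound (f : cm) b : (forall n, (b <= val n)%N -> f n = 0) ->
  cm_lift_fun f =
  \sum_(i < b) oapp (fun n : didx m => (f n : k) *: g n) 0 (insub (i : nat)).
Proof.
pose G i := oapp (fun n : didx m => (f n : k) *: g n) 0 (insub i).
have H b' c : (forall n, (b' <= val n)%N -> f n = 0) ->
    (b' <= c)%N -> \sum_(i < c) G i = \sum_(i < b') G i.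
  move=> fb bc; rewrite (big_ord_widen_cond _ xpredT G bc) [RHS]big_mkcond.
  apply: eq_bigr => i _; case: ifPn => //; rewrite /= -leqNgt => bi.
  rewrite /G; case: insubP => [n _ nE|//]; rewrite /= fb ?scale0r //.
  by rewrite nE.
move=> fb; rewrite /cm_lift_fun /cm_bound; case: cid => /= c fc.
rewrite -/(G _).
by rewrite -(H b (maxn b c)) ?leq_maxl // -(H c (maxn b c)) ?leq_maxr.
Qed.

Lemma cm_lift_linear : linear cm_lift_fun.
Proof.
move=> a f h; have [b fb] := cmP f; have [c hc] := cmP h.
have fd n : (maxn b c <= val n)%N -> f n = 0.
  by rewrite geq_max => /andP[bn _]; apply: fb.
have hd n : (maxn b c <= val n)%N -> h n = 0.
  by rewrite geq_max => /andP[_ cn]; apply: hc.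
rewrite (cm_lift_bound fd) (cm_lift_bound hd) (@cm_lift_bound _ (maxn b c)).
  rewrite scaler_sumr -big_split; apply: eq_bigr => i _ /=.
  case: insub => [n|] /=; last by rewrite scaler0 addr0.
  by rewrite scalerA -scalerDl.
by move=> n bn; rewrite -[LHS]/(a * f n + h n) fd // hd // mulr0 addr0.
Qed.

Definition cm_lift : {linear cm -> V} := mklin cm_lift_linear.

Lemma cm_lift_v n : cm_lift (cm_v n) = g n.
Proof.
rewrite -[LHS]/(cm_lift_fun _) (@cm_lift_bound _ (val n).+1); last first.
  by move=> i; rewrite /=; case: eqP => // ->; rewrite ltnn.
rewrite big_ord_recr /= big1 ?add0r => [|i _].
  by rewrite valK /= eqxx scale1r.
case: insubP => [j _ jE|//] /=; rewrite (_ : (j == n) = false) ?scale0r //.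
by apply/eqP => jn; move: (ltn_ord i); rewrite -jE jn ltnn.
Qed.

End Lift.

Lemma cm_decomp (f : cm) : f = cm_lift cm_v f.
Proof.
have [b fb] := cmP f; rewrite -[RHS]/(cm_lift_fun _ _) (cm_lift_bound _ fb).
apply: val_inj; rewrite (@raddf_sum _ _ (val : cm -> _)); apply/funext => n.
rewrite fct_sumE /=.
have [bn|nb] := leqP b (val n).
  rewrite fb // big1 // => i _; case: insubP => [j _ jE|//] /=.
  rewrite -[LHS]/((f j : k) * (n == j)%:R) (_ : (n == j) = false) ?mulr0 //.
  by apply/eqP => nj; move: (ltn_ord i); rewrite -jE -nj ltnNge bn.
rewrite (bigD1 (Ordinal nb)) //= valK /= big1 => [|i ni].
  by rewrite addr0 -[RHS]/((f n : k) * (n == n)%:R) eqxx mulr1.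
case: insubP => [j _ jE|//] /=.
rewrite -[LHS]/((f j : k) * (n == j)%:R) (_ : (n == j) = false) ?mulr0 //.
by apply/eqP => nj; case/eqP: ni; apply: val_inj; rewrite /= nj jE.
Qed.

Lemma cm_ext (V : lmodType k) (f g : {linear cm -> V}) :
  (forall n, f (cm_v n) = g (cm_v n)) -> f = g.
Proof.
move=> fg; apply: lin_ext => u; rewrite [u]cm_decomp.
rewrite -[cm_lift _ _]/(cm_lift_fun _ _) /cm_lift_fun !linear_sum.
by apply: eq_bigr => i _; case: insub => [n|] /=; rewrite ?linear0 // !linearZ fg.
Qed.

End FreeModule.

Arguments cm_v k {m} n.

Section Cm.
Variables (k : comPzRingType) (m : option nat).

Definition cm_comul : {linear cm k m -> cm k m ⊗ cm k m} :=
  cm_lift (fun n => \dsum_(i + j == n) (cm_v k i ⊗t cm_v k j)).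

Definition cm_counit : {linear cm k m -> k^o} :=
  cm_lift (fun n => (n == didx0)%:R : k^o).

Lemma cm_comul_v n :
  cm_comul (cm_v k n) = \dsum_(i + j == n) (cm_v k i ⊗t cm_v k j).
Proof. exact: cm_lift_v. Qed.

Lemma cm_counit_v n : cm_counit (cm_v k n) = (n == didx0)%:R.
Proof. exact: cm_lift_v. Qed.

Lemma sum_triangle (V : nmodType) (F : nat -> nat -> nat -> V) n :
  \sum_(i < n.+1) \sum_(a < i.+1) F a (i - a)%N (n - i)%N =
  \sum_(a < n.+1) \sum_(b < (n - a).+1) F a b (n - a - b)%N.
Proof.
transitivity (\sum_(i < n.+1) \sum_(a < n.+1 | (a < i.+1)%N)
    F a (i - a)%N (n - i)%N).
  apply: eq_bigr => i _.
  exact: (big_ord_widen _ (fun a => F a (i - a)%N (n - i)%N) (ltn_ord i)).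
rewrite (exchange_big_dep xpredT) //=; apply: eq_bigr => a _.
rewrite -(big_geq_mkord _ _ xpredT (fun i => F a (i - a)%N (n - i)%N)).
have an : (a <= n)%N by rewrite -ltnS.
rewrite -{1}[nat_of_ord a]add0n big_addn big_mkord subSn //.
by apply: eq_bigr => b _; rewrite addnK subnDA subnAC.
Qed.

Definition cm_w (i : nat) : cm k m := oapp (cm_v k) 0 (insub i : option (didx m)).

Lemma cm_wE (n : didx m) : cm_w (val n) = cm_v k n.
Proof. by rewrite /cm_w valK. Qed.

Lemma cm_comul_w n : le_len n m ->
  cm_comul (cm_w n) = \sum_(i < n.+1) (cm_w i ⊗t cm_w (n - i)).
Proof.
move=> nm; rewrite -[n]/(val (exist _ n nm : didx m)) cm_wE cm_comul_v.
by apply: eq_bigr => i _; rewrite -!cm_wE.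
Qed.

Lemma cm_coassoc c : tassoc (tmap cm_comul (lid _) (cm_comul c)) =
                     tmap (lid _) cm_comul (cm_comul c).
Proof.
rewrite -[LHS]/(lcomp (lcomp tassoc (tmap cm_comul (lid _))) cm_comul c).
rewrite -[RHS]/(lcomp (tmap (lid _) cm_comul) cm_comul c).
congr (GRing.Linear.sort _ c); apply: cm_ext => n.
rewrite [LHS]lcompE [RHS]lcompE -cm_wE cm_comul_w ?(valP n) //.
rewrite [LHS]linear_sum [RHS]linear_sum.
have sn i : (i <= val n)%N -> le_len i m by move/le_lenW; apply; apply: valP n.
pose F a b c := cm_w a ⊗t (cm_w b ⊗t cm_w c).
transitivity (\sum_(i < (val n).+1) \sum_(a < i.+1) F a (i - a)%N (val n - i)%N).
  apply: eq_bigr => i _; rewrite lcompE tmap_tens lidE.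
  rewrite cm_comul_w; last by rewrite sn // -ltnS.
  rewrite -[_ ⊗t _]/(mklin (tens_bilin.1 (cm_w (val n - i))) _).
  rewrite [X in tassoc X]linear_sum [LHS]linear_sum.
  by apply: eq_bigr => a _; rewrite -[mklin _ _]/(_ ⊗t _) tassoc_tens.
rewrite sum_triangle; apply: eq_bigr => a _.
rewrite tmap_tens lidE cm_comul_w ?sn ?leq_subr //.
by rewrite -[RHS]/(mklin (tens_bilin.2 (cm_w a)) _) linear_sum.
Qed.

Lemma cm_counit_w n : cm_counit (cm_w n) = (n == 0%N)%:R.
Proof.
rewrite /cm_w; case: insubP => [j _ <-|/=]; first exact: cm_counit_v.
by case: n => [|n _]; rewrite ?le_len0 // linear0.
Qed.

Lemma cm_counitl c : \tsum_(x, y <- cm_comul c) (cm_counit x *: y) = c.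
Proof.
have b : bilin (fun x y : cm k m => (cm_counit x : k) *: y).
  by split=> [y a x x'|x a y y']; rewrite ?linearP /= ?scalerDl ?scalerDr
    !scalerA // mulrC.
rewrite -[LHS]/(lcomp (tlift b) cm_comul c) -[RHS]/(lid _ c).
congr (GRing.Linear.sort _ c); apply: cm_ext => n.
rewrite lcompE lidE -cm_wE cm_comul_w ?(valP n) // linear_sum big_ord_recl.
rewrite big1 => [|i _]; rewrite /= tlift_tens cm_counit_w ?scale0r //.
by rewrite scale1r addr0 subn0.
Qed.

Lemma cm_counitr c : \tsum_(x, y <- cm_comul c) (cm_counit y *: x) = c.
Proof.
have b : bilin (fun x y : cm k m => (cm_counit y : k) *: x).
  by split=> [y a x x'|x a y y']; rewrite ?linearP /= ?scalerDl ?scalerDr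
    !scalerA // mulrC.
rewrite -[LHS]/(lcomp (tlift b) cm_comul c) -[RHS]/(lid _ c).
congr (GRing.Linear.sort _ c); apply: cm_ext => n.
rewrite lcompE lidE -cm_wE cm_comul_w ?(valP n) // linear_sum big_ord_recr.
rewrite big1 => [|i _]; rewrite /= tlift_tens cm_counit_w.
  by rewrite subnn scale1r add0r.
by rewrite subn_eq0 leqNgt ltn_ord scale0r.
Qed.

Definition Cm_coalgebra : coalgebra k :=
  Coalgebra cm_coassoc cm_counitl cm_counitr.

Definition Cm : comodule k := comod_self Cm_coalgebra.

End Cm.

(* Main.v *)
Require Import Defs.
From mathcomp Require Import all_boot all_algebra.
From mathcomp Require Import boolp.

Set Implicit Arguments.
Unset Strict Implicit.
Unset Printing Implicit Defensive.

Import GRing.Theory.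

Local Open Scope ring_scope.

(** The coalgebra [Cm k m] is free on the v_n, and its comultiplication spreads
    v_n over the pairs i + j = n.  A linear map [U ⊗ cm k m -> V] is therefore
    the same thing as a family of linear maps [U -> V] indexed by [didx m]
    ([fam_pair], [pair_fam]), and the multiplicativity of a measuring, tested on
    the v_n, is the Leibniz rule ([leibniz_pairing]).  The conditions on units
    also agree: for a derivation D the element sum_n D_n(1) t^n is an idempotent
    power series with constant term 1, hence equal to 1 ([hder_one]), and this
    is what [counit] demands of a measuring.  This gives the first bijection.

    The second bijection is the universal property of Q(M, N): its naturality is
    built into the way Q is made functorial.  For the third, currying turns
    measurings M, X -> N into module morphisms from M to the convolution module
    [X, N] ([meas_curry]), and the adjunction turns these into morphisms out of
    the tensor; each step commutes with the actions of morphisms.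

    Composition of derivations is the Cauchy product of families,
    (E D)_n = sum_(i + j = n) E_i D_j, as for power series in t.  It is
    associative because sums over triples of indices can be bracketed either way
    ([dsum_assoc]), and it preserves the Leibniz rule because the two middle
    indices of a sum over quadruples can be exchanged ([dsum_interchange]).
    This exchange is the cocommutativity of [Cm k m]. *)

(** * Sums over pairs of indices *)

Section IndexSums.
Context {m : option nat} {V : nmodType}.

Lemma lidx_ord0 (n : didx m) : lidx (ord0 : 'I_(val n).+1) = didx0.
Proof. exact: val_inj. Qed.

Lemma ridx_ord0 (n : didx m) : ridx (ord0 : 'I_(val n).+1) = n.
Proof. by apply: val_inj; rewrite /= subn0. Qed.

(** Both sides run over the triples of indices with sum n. *)
Lemma dsum_assoc (F : didx m -> didx m -> didx m -> V) n :
  \dsum_(i + c == n) (\dsum_(a + b == i) F a b c) =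
  \dsum_(a + j == n) (\dsum_(b + c == j) F a b c).
Proof.
(* The inner ranges depend on the outer index, so F is extended by zero to nat,
   where the triangular reindexing of sums applies. *)
pose G (a b c : nat) : V :=
  if (insub a, insub b, insub c) is (Some a', Some b', Some c')
  then F a' b' c' else 0.
have GE a b c : F a b c = G (val a) (val b) (val c) by rewrite /G !valK.
transitivity (\sum_(i < (val n).+1) \sum_(a < i.+1) G a (i - a)%N (val n - i)%N).
  by apply: eq_bigr => i _; apply: eq_bigr => a _; apply: GE.
rewrite sum_triangle.
by apply: eq_bigr => a _; apply: eq_bigr => b _; rewrite GE.
Qed.

Lemma dsum_comm (F : didx m -> didx m -> V) n :
  \dsum_(i + j == n) F i j = \dsum_(i + j == n) F j i.
Proof.
rewrite (reindex_inj rev_ord_inj) /=; apply: eq_bigr => r _.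
have rn : (r <= val n)%N by rewrite -ltnS.
by congr (F _ _); apply: val_inj; rewrite /= subSS ?subKn.
Qed.

(** Both sides run over the quadruples of indices with sum n; only the bracketing
    differs, by a swap of the two middle indices. *)
Lemma dsum_interchange (F : didx m -> didx m -> didx m -> didx m -> V) n :
  \dsum_(i + j == n)
    (\dsum_(s + t == i) (\dsum_(p + q == j) F s t p q)) =
  \dsum_(i + j == n)
    (\dsum_(s + p == i) (\dsum_(t + q == j) F s t p q)).
Proof.
rewrite (dsum_assoc (fun s t j => \dsum_(p + q == j) F s t p q)).
rewrite (dsum_assoc (fun s p j => \dsum_(t + q == j) F s t p q)).
apply: eq_bigr => r _.
apply: etrans (esym (dsum_assoc (F (lidx r)) (ridx r))) _.
apply: etrans (dsum_assoc (fun p t => F (lidx r) t p) (ridx r)).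
apply: eq_bigr => u _.
exact: (dsum_comm (fun t p => F (lidx r) t p (ridx u))).
Qed.

Lemma dsum_unitl (F : didx m -> didx m -> V) n :
  (forall i j, i != didx0 -> F i j = 0) -> \dsum_(i + j == n) F i j = F didx0 n.
Proof.
move=> F0; rewrite big_ord_recl lidx_ord0 ridx_ord0 big1 ?addr0 // => i _.
exact: F0.
Qed.

Lemma dsum_unitr (F : didx m -> didx m -> V) n :
  (forall i j, j != didx0 -> F i j = 0) -> \dsum_(i + j == n) F i j = F n didx0.
Proof.
move=> F0; rewrite dsum_comm (dsum_unitl (F := fun j i => F i j)) //.
by move=> j i; apply: F0.
Qed.

End IndexSums.

(** * Leibniz families *)

Section Leibniz.
Context {k : comPzRingType} {m : option nat}.

(** The operations are arbitrary so that the rule for the multiplication of an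
    algebra and the rule for the action on a module are two instances. *)
Definition leibniz (U V W U' V' W' : lmodType k)
    (op : U -> V -> W) (op' : U' -> V' -> W')
    (f : didx m -> {linear U -> U'}) (g : didx m -> {linear V -> V'})
    (h : didx m -> {linear W -> W'}) : Prop :=
  forall n x y, h n (op x y) = \dsum_(i + j == n) op' (f i x) (g j y).

Lemma lin_sumE (U V : lmodType k) (I : Type) (r : seq I)
    (F : I -> {linear U -> V}) x :
  (\sum_(i <- r) F i) x = \sum_(i <- r) F i x.
Proof.
by elim: r => [|i r IH]; rewrite ?big_nil // !big_cons linD IH.
Qed.

Lemma bilin_suml (U V W : lmodType k) (op : U -> V -> W) (I : Type)
    (r : seq I) (F : I -> U) y :
  bilin op -> op (\sum_(i <- r) F i) y = \sum_(i <- r) op (F i) y.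
Proof. by move=> [opl _]; apply: (linear_sum (mklin (opl y))). Qed.

Lemma bilin_sumr (U V W : lmodType k) (op : U -> V -> W) (I : Type)
    (r : seq I) (F : I -> V) x :
  bilin op -> op x (\sum_(i <- r) F i) = \sum_(i <- r) op x (F i).
Proof. by move=> [_ opr]; apply: (linear_sum (mklin (opr x))). Qed.

Definition fam_id (U : lmodType k) (n : didx m) : {linear U -> U} :=
  if n == didx0 then lid U else 0.

Definition fam_comp (U V W : lmodType k) (e : didx m -> {linear V -> W})
    (d : didx m -> {linear U -> V}) (n : didx m) : {linear U -> W} :=
  \dsum_(i + j == n) lcomp (e i) (d j).

Lemma fam_idE (U : lmodType k) n (x : U) :
  fam_id U n x = if n == didx0 then x else 0.
Proof. by rewrite /fam_id; case: eqP. Qed.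

Lemma fam_compE (U V W : lmodType k) (e : didx m -> {linear V -> W})
    (d : didx m -> {linear U -> V}) n x :
  fam_comp e d n x = \dsum_(i + j == n) e i (d j x).
Proof. by rewrite /fam_comp lin_sumE. Qed.

Lemma fam_comp0 (U V W : lmodType k) (e : didx m -> {linear V -> W})
    (d : didx m -> {linear U -> V}) :
  fam_comp e d didx0 = lcomp (e didx0) (d didx0).
Proof. by rewrite /fam_comp big_ord1 lidx_ord0 ridx_ord0. Qed.

Lemma fam_compA (U V W T : lmodType k) (c : didx m -> {linear W -> T})
    (e : didx m -> {linear V -> W}) (d : didx m -> {linear U -> V}) n x :
  fam_comp c (fam_comp e d) n x = fam_comp (fam_comp c e) d n x.
Proof.
rewrite !fam_compE.
transitivity (\dsum_(a + j == n) (\dsum_(b + l == j) c a (e b (d l x)))).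
  by apply: eq_bigr => r _; rewrite fam_compE linear_sum.
rewrite -(dsum_assoc (fun a b l => c a (e b (d l x)))).
by apply: eq_bigr => r _; rewrite fam_compE.
Qed.

Lemma fam_comp_idl (U V : lmodType k) (d : didx m -> {linear U -> V}) n x :
  fam_comp (fam_id V) d n x = d n x.
Proof.
rewrite fam_compE (dsum_unitl (F := fun i j => fam_id V i (d j x))) ?fam_idE //.
by move=> i j i0; rewrite fam_idE (negPf i0).
Qed.

Lemma fam_comp_idr (U V : lmodType k) (d : didx m -> {linear U -> V}) n x :
  fam_comp d (fam_id U) n x = d n x.
Proof.
rewrite fam_compE (dsum_unitr (F := fun i j => d i (fam_id U j x))) ?fam_idE //.
by move=> i j j0; rewrite fam_idE (negPf j0) linear0.
Qed.

Lemma leibniz_id (U V W : lmodType k) (op : U -> V -> W) :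
  bilin op -> leibniz op op (fam_id U) (fam_id V) (fam_id W).
Proof.
move=> bop n x y.
rewrite (dsum_unitl (F := fun i j => op (fam_id U i x) (fam_id V j y))).
  by rewrite !fam_idE eqxx; case: ifP => // _; rewrite (bilin0r bop).
by move=> i j i0; rewrite fam_idE (negPf i0) (bilin0l bop).
Qed.

(** Expanding h'_i (h_j (op x y)) distributes i over the pair (s, t) and j over
    the pair (p, q), whereas the composites on the right need the pairs (s, p)
    and (t, q): [dsum_interchange] passes from one to the other. *)
Lemma leibniz_comp (U V W U' V' W' U'' V'' W'' : lmodType k)
    (op : U -> V -> W) (op' : U' -> V' -> W') (op'' : U'' -> V'' -> W'')
    f g h f' g' h' :
  bilin op'' -> leibniz op op' f g h -> leibniz op' op'' f' g' h' ->
  leibniz op op'' (fam_comp f' f) (fam_comp g' g) (fam_comp h' h).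
Proof.
move=> bop L L' n x y; rewrite fam_compE.
pose F s t p q := op'' (f' s (f p x)) (g' t (g q y)).
transitivity (\dsum_(i + j == n)
    (\dsum_(s + t == i) (\dsum_(p + q == j) F s t p q))).
  apply: eq_bigr => r _; rewrite L linear_sum exchange_big /=.
  by apply: eq_bigr => a _; rewrite L'.
rewrite dsum_interchange; apply: eq_bigr => r _.
rewrite !fam_compE bilin_suml //; apply: eq_bigr => a _.
by rewrite bilin_sumr.
Qed.

End Leibniz.

(** * The category of module derivations *)

Section DerivationCategory.
Context {k : comPzRingType} {m : option nat}.

Section Identity.
Variable M : rmodule k.

Lemma fam_id_monoid (A : algebra k) :
  monoid_morphism (fam_id A (didx0 : didx m)).
Proof. by rewrite /fam_id eqxx. Qed.

Definition mder_id : module_derivation m M M :=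
  @ModuleDerivation k m M M
    (HigherDerivation (fam_id_monoid _) (leibniz_id (mul_bilin (rm_alg M))))
    (fam_id M) (leibniz_id (ract_bilin M)).

End Identity.

Section Composition.
Variables (M N P : rmodule k).
Variables (E : module_derivation m N P) (D : module_derivation m M N).

Lemma fam_comp_monoid :
  monoid_morphism (fam_comp (mder_alg E) (mder_alg D) didx0).
Proof. by rewrite fam_comp0; apply: lcomp_monoid; apply: hder0. Qed.

Definition mder_comp : module_derivation m M P :=
  @ModuleDerivation k m M P
    (HigherDerivation fam_comp_monoid
       (leibniz_comp (mul_bilin (rm_alg P)) (@hderM _ _ _ _ (mder_alg D))
          (@hderM _ _ _ _ (mder_alg E))))
    (fam_comp (mder_mod E) (mder_mod D))
    (leibniz_comp (ract_bilin P) (mder_act D) (mder_act E)).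

End Composition.

Lemma mder_compA M N P Q (F : module_derivation m P Q)
    (E : module_derivation m N P) (D : module_derivation m M N) :
  mder_comp F (mder_comp E D) = mder_comp (mder_comp F E) D.
Proof. by apply: module_derivation_ext => n x; apply: fam_compA. Qed.

Lemma mder_comp1l M N (D : module_derivation m M N) :
  mder_comp (mder_id N) D = D.
Proof. by apply: module_derivation_ext => n x; apply: fam_comp_idl. Qed.

Lemma mder_comp1r M N (D : module_derivation m M N) :
  mder_comp D (mder_id M) = D.
Proof. by apply: module_derivation_ext => n x; apply: fam_comp_idr. Qed.

Definition mder_is_category : is_category (@module_derivation k m) :=
  IsCategory mder_compA mder_comp1l mder_comp1r.

End DerivationCategory.

(** * Derivations as measurings *)

Section Pairing.
Context {k : comPzRingType} {m : option nat}.

Section Def.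
Context {U V : lmodType k}.

Lemma fam_pair_bilin (f : didx m -> {linear U -> V}) :
  bilin (fun x (c : cm k m) => cm_lift (fun n => f n x) c).
Proof.
split=> [c a x x'|x]; last exact: linearP.
rewrite -linZ -linD; congr (GRing.Linear.sort _ c); apply: cm_ext => n.
by rewrite linD linZ !cm_lift_v linearP.
Qed.

(** The generating function of the family f: x ⊗ v_n goes to f_n x. *)
Definition fam_pair (f : didx m -> {linear U -> V}) :
  {linear U ⊗ cm k m -> V} := tlift (fam_pair_bilin f).

Lemma fam_pair_v f x n : fam_pair f (x ⊗t cm_v k n) = f n x.
Proof. by rewrite tlift_tens cm_lift_v. Qed.

Definition pair_fam (phi : {linear U ⊗ cm k m -> V}) (n : didx m) :
    {linear U -> V} :=
  lcomp phi (mklin (tens_bilin.1 (cm_v k n))).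

Lemma pair_famE phi n x : pair_fam phi n x = phi (x ⊗t cm_v k n).
Proof. by []. Qed.

End Def.

Definition ptens (U V : lmodType k) (x : U) : {linear V -> U ⊗ V} :=
  mklin (tens_bilin.2 x).

(** Linear maps out of [cm k m] are determined by their values on the v_n. *)
Lemma pairing_ext (U V : lmodType k) (phi psi : {linear U ⊗ cm k m -> V}) :
  (forall x n, phi (x ⊗t cm_v k n) = psi (x ⊗t cm_v k n)) ->
  forall x c, phi (x ⊗t c) = psi (x ⊗t c).
Proof.
move=> pq x c.
rewrite -[LHS]/(lcomp phi (ptens _ x) c) -[RHS]/(lcomp psi (ptens _ x) c).
by congr (GRing.Linear.sort _ c); apply: cm_ext => n; apply: pq.
Qed.

(** On c = v_n the comultiplication turns the right-hand side of the measuring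
    condition into the sum of the Leibniz rule, and both sides are linear in c,
    so the values at the v_n decide. *)
Lemma leibniz_pairing (U V W U' V' W' : lmodType k)
    (op : U -> V -> W) (op' : U' -> V' -> W')
    (f : {linear U ⊗ cm k m -> U'}) (g : {linear V ⊗ cm k m -> V'})
    (h : {linear W ⊗ cm k m -> W'}) :
  bilin op' ->
  leibniz op op' (pair_fam f) (pair_fam g) (pair_fam h) <->
  (forall x y c, h (op x y ⊗t c) =
     \tsum_(c1, c2 <- cm_comul k m c) op' (f (x ⊗t c1)) (g (y ⊗t c2))).
Proof.
move=> bop.
pose b x y := bilin_comp (lcomp f (ptens _ x)) (lcomp g (ptens _ y)) (lid _) bop.
have tsum_v x y n :
  \tsum_(c1, c2 <- cm_comul k m (cm_v k n)) op' (f (x ⊗t c1)) (g (y ⊗t c2)) =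
  \dsum_(i + j == n) op' (pair_fam f i x) (pair_fam g j y).
  rewrite cm_comul_v -[LHS]/(tlift (b x y) _) linear_sum.
  by apply: eq_bigr => r _; rewrite tlift_tens.
split=> [L x y c | L n x y]; last by rewrite -tsum_v -L.
rewrite -[LHS]/(lcomp h (ptens _ (op x y)) c).
rewrite -[RHS]/(lcomp (tlift (b x y)) (cm_comul k m) c).
congr (GRing.Linear.sort _ c); apply: cm_ext => n.
transitivity (pair_fam h n (op x y)); first by [].
by rewrite L -tsum_v.
Qed.

End Pairing.

(** A higher derivation is only required to be unital in degree 0; the Leibniz
    rule for 1 * 1 gives the other degrees. By induction the terms with both
    indices positive vanish, which leaves D_n(1) = D_n(1) + D_n(1). *)
Lemma hder_one (k : comPzRingType) (m : option nat) (A B : algebra k)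
    (D : higher_derivation m A B) n : D n 1 = if n == didx0 then 1 else 0.
Proof.
have [D1 _] := hder0 D.
case: eqP => [->|/eqP n0]; first exact: D1.
have [b] := ubnP (val n); elim: b n n0 => // b IH n n0; rewrite ltnS => nb.
have : D n 1 = D n 1 + D n 1.
  have [p np] : exists p, val n = p.+1.
    case E: (val n) => [|p]; last by exists p.
    by case/eqP: n0; apply: val_inj.
  rewrite -{1}[1](mulr1 1) hderM.
  rewrite (bigD1 ord0) //= (bigD1 ord_max) //= big1 ?addr0.
    rewrite lidx_ord0 ridx_ord0 D1 mul1r.
    have -> : lidx (ord_max : 'I_(val n).+1) = n by apply: val_inj.
    have -> : ridx (ord_max : 'I_(val n).+1) = didx0.
      by apply: val_inj; rewrite /= subnn.
    by rewrite D1 mulr1.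
  move=> r /andP[r0 rn]; rewrite IH ?mul0r //.
  apply: leq_trans nb; rewrite ltn_neqAle -ltnS ltn_ord andbT.
  by apply: contraNneq rn => rn; apply/eqP/val_inj.
by rewrite -{1}[D n 1]addr0 => /addrI.
Qed.

Section DerivationMeasuring.
Context {k : comPzRingType} {m : option nat} {M N : rmodule k}.

Lemma pair_famK (U V : lmodType k) (f : didx m -> {linear U -> V}) :
  pair_fam (fam_pair f) = f.
Proof.
by apply/funext => n; apply: lin_ext => x; rewrite pair_famE fam_pair_v.
Qed.

Section ToMeasuring.
Variable D : module_derivation m M N.

Lemma mder_meas_algM (a a' : rm_alg M) (c : com_coalg (Cm k m)) :
  fam_pair (mder_alg D) ((a * a') ⊗t c) =
  \tsum_(c1, c2 <- comul _ c)
    (fam_pair (mder_alg D) (a ⊗t c1) * fam_pair (mder_alg D) (a' ⊗t c2)).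
Proof.
apply: (leibniz_pairing _ _ _ _ (mul_bilin (rm_alg N))).1; rewrite pair_famK.
exact: hderM.
Qed.

Lemma mder_meas_alg1 (c : com_coalg (Cm k m)) :
  fam_pair (mder_alg D) ((1 : rm_alg M) ⊗t c) =
  counit _ c *: (1 : rm_alg N).
Proof.
rewrite -[LHS]/(lcomp (fam_pair (mder_alg D)) (ptens _ (1 : rm_alg M)) c).
rewrite -[RHS]/(conv_one (Cm_coalgebra k m) (rm_alg N) c).
congr (GRing.Linear.sort _ c); apply: cm_ext => n.
rewrite lcompE -[LHS]/(fam_pair (mder_alg D) (_ ⊗t _)) fam_pair_v hder_one.
rewrite -[RHS]/((cm_counit k m (cm_v k n) : k) *: (1 : rm_alg N)) cm_counit_v.
by case: ifP; rewrite ?scale1r ?scale0r.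
Qed.

Lemma mder_meas_act (u : M) (a : rm_alg M) (x : Cm k m) :
  fam_pair (mder_mod D) (ract u a ⊗t x) =
  \tsum_(x0, x1 <- coact (Cm k m) x)
    ract (fam_pair (mder_mod D) (u ⊗t x0)) (fam_pair (mder_alg D) (a ⊗t x1)).
Proof.
apply: (leibniz_pairing _ _ _ _ (ract_bilin N)).1; rewrite !pair_famK.
exact: mder_act.
Qed.

Definition mder_meas : measuring M (Cm k m) N :=
  @Measuring k M (Cm k m) N _ _ mder_meas_algM mder_meas_alg1 mder_meas_act.

End ToMeasuring.

Section FromMeasuring.
Variable u : measuring M (Cm k m) N.
Let D : didx m -> {linear rm_alg M -> rm_alg N} := pair_fam (meas_alg u).
Let d : didx m -> {linear M -> N} := pair_fam (meas_mod u).

Lemma meas_mder_algM : leibniz (@amul k (rm_alg M)) (@amul k (rm_alg N)) D D D.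
Proof. exact: (leibniz_pairing _ _ _ _ (mul_bilin (rm_alg N))).2 (meas_algM u). Qed.

Lemma meas_mder_alg0 : monoid_morphism (D didx0).
Proof.
split=> [|x y].
  rewrite /D pair_famE meas_alg1 -[counit _ _]/(cm_counit k m (cm_v k didx0)).
  by rewrite cm_counit_v scale1r.
by rewrite meas_mder_algM big_ord1 lidx_ord0 ridx_ord0.
Qed.

Lemma meas_mder_act : leibniz (@ract k M) (@ract k N) d D d.
Proof. exact: (leibniz_pairing _ _ _ _ (ract_bilin N)).2 (meas_act u). Qed.

Definition meas_mder : module_derivation m M N :=
  @ModuleDerivation k m M N
    (HigherDerivation meas_mder_alg0 meas_mder_algM) d meas_mder_act.

End FromMeasuring.

Lemma mder_measK : cancel mder_meas meas_mder.
Proof.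
by move=> D; apply: module_derivation_ext => n x; apply: fam_pair_v.
Qed.

Lemma meas_mderK : cancel meas_mder mder_meas.
Proof.
by move=> u; apply: measuring_ext; apply: pairing_ext => x n;
   rewrite fam_pair_v.
Qed.

End DerivationMeasuring.

Lemma mder_meas_natural (k : comPzRingType) (m : option nat) :
  @natural_bijection (Mod k) (MDer k m) (Meas (Cm k m))
    (@mder_meas k m).
Proof.
split=> [M N|M M' N N' f g D].
  exists meas_mder; [exact: mder_measK | exact: meas_mderK].
apply: measuring_ext; apply: pairing_ext => x n.
  by rewrite meas_map_algE [LHS]fam_pair_v [X in rmh_alg g X]fam_pair_v.
by rewrite meas_map_modE [LHS]fam_pair_v [X in rmh_mod g X]fam_pair_v.
Qed.

(** * Measurings as morphisms into the universal measuring comodule *)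

(** Naturality can be tested after the injective [univ_meas], under which the
    action of morphisms on Q becomes the action on measurings. *)
Lemma univ_hom_natural (k : comPzRingType)
    (Q : forall M N : rmodule k, universal_comodule M N) (X : comodule k) :
  @natural_bijection (Mod k) (Meas X) (Comod_into Q X)
    (fun M N => @univ_hom k M N (Q M N) X).
Proof.
split=> [M N|M M' N N' f g u].
  exists (@univ_meas k M N (Q M N) X); [exact: univ_homK | exact: univ_measK].
by apply: univ_meas_inj; rewrite univ_meas_map !univ_homK.
Qed.

(** * Measurings as module morphisms into convolution modules *)

Section Currying.
Context {k : comPzRingType}.

Section Linear.
Context {U V W : lmodType k}.

Lemma tcurry_linear (phi : {linear U ⊗ V -> W}) :
  linear (fun x => lcomp phi (ptens V x)).
Proof.
move=> a x x'; apply: lin_ext => y.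
rewrite lcompE linD linZ !lcompE -linearP.
by congr (phi _); apply: tens_bilin.1.
Qed.

Definition tcurry (phi : {linear U ⊗ V -> W}) : {linear U -> {linear V -> W}} :=
  mklin (tcurry_linear phi).

Lemma tcurryE phi x y : tcurry phi x y = phi (x ⊗t y).
Proof. by []. Qed.

Lemma tuncurry_bilin (f : {linear U -> {linear V -> W}}) :
  bilin (fun x y => f x y).
Proof.
by split=> [y a x x'|x]; [rewrite linearP | exact: linearP].
Qed.

Definition tuncurry (f : {linear U -> {linear V -> W}}) :
  {linear U ⊗ V -> W} := tlift (tuncurry_bilin f).

Lemma tuncurryE f x y : tuncurry f (x ⊗t y) = f x y.
Proof. exact: tlift_tens. Qed.

End Linear.

Context {M N : rmodule k} {X : comodule k}.
Let C := com_coalg X.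

Section ToHom.
Variable u : measuring M X N.
Let f : {linear rm_alg M -> conv C (rm_alg N)} := tcurry (meas_alg u).
Let p : {linear M -> conv_module X N} := tcurry (meas_mod u).

Lemma meas_curry_monoid : monoid_morphism f.
Proof.
split=> [|a b]; apply: lin_ext => c; first exact: meas_alg1.
exact: meas_algM.
Qed.

Lemma meas_curry_act x a : p (ract x a) = ract (p x) (f a).
Proof. by apply: lin_ext => y; apply: meas_act. Qed.

(** The algebra and action of the convolution module are defined by the
    formulas that occur in the axioms of a measuring, so these axioms say
    pointwise that the curried maps form a module morphism. *)
Definition meas_curry : rmod_hom M (conv_module X N) :=
  @RModHom k M (conv_module X N) f p meas_curry_monoid meas_curry_act.

End ToHom.

Section FromHom.
Variable h : rmod_hom M (conv_module X N).
Let phi : {linear rm_alg M ⊗ C -> rm_alg N} := tuncurry (rmh_alg h).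
Let psi : {linear M ⊗ X -> N} := tuncurry (rmh_mod h).

Lemma meas_uncurry_algM (a a' : rm_alg M) (c : C) : phi ((a * a') ⊗t c) =
  \tsum_(c1, c2 <- comul _ c) (phi (a ⊗t c1) * phi (a' ⊗t c2)).
Proof.
have [_ hM] := rmh_algM h; rewrite /phi tuncurryE hM.
by rewrite [LHS]conv_mulE; apply: eq_tsum => x y; rewrite !tuncurryE.
Qed.

Lemma meas_uncurry_alg1 (c : C) :
  phi ((1 : rm_alg M) ⊗t c) = counit _ c *: (1 : rm_alg N).
Proof. by have [h1 _] := rmh_algM h; rewrite /phi tuncurryE h1. Qed.

Lemma meas_uncurry_act v a x : psi (ract v a ⊗t x) =
  \tsum_(x0, x1 <- coact X x) ract (psi (v ⊗t x0)) (phi (a ⊗t x1)).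
Proof.
rewrite /psi /phi tuncurryE rmh_act [LHS]conv_actE.
by apply: eq_tsum => y c; rewrite !tuncurryE.
Qed.

Definition meas_uncurry : measuring M X N :=
  Measuring meas_uncurry_algM meas_uncurry_alg1 meas_uncurry_act.

End FromHom.

Lemma meas_curryK : cancel meas_curry meas_uncurry.
Proof. by move=> u; apply: measuring_ext => x c; apply: tuncurryE. Qed.

Lemma meas_uncurryK : cancel meas_uncurry meas_curry.
Proof.
by move=> h; apply: rmod_hom_ext => x; apply: lin_ext => c; apply: tuncurryE.
Qed.

End Currying.

Lemma meas_curry_map (k : comPzRingType) (X : comodule k) (M M' N N' : Mod k)
    (f : mor M' M) (g : mor N N') (u : measuring M X N) :
  (meas_curry (meas_map f (comod_id X) g u) : mor M' (conv_functor X N')) =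
  fmap (conv_functor X) g \oc meas_curry u \oc f.
Proof.
apply: rmod_hom_ext => x; apply: lin_ext => c.
  exact: meas_map_algE.
exact: meas_map_modE.
Qed.

Section Tensor.
Context {k : comPzRingType} {X : comodule k}.
Variables (Q : forall M N : rmodule k, universal_comodule M N).
Variables (T : functor (Mod k) (Mod k)) (adjT : adjunction T (conv_functor X)).

(** A comodule morphism X -> Q(M, N) is read as a measuring, then as a module
    morphism M -> [X, N], then transposed along the adjunction. *)
Definition comod_hom_from (M N : Mod k) (t : Comod_into Q X M N) :
  hom_from T M N := adjV adjT (meas_curry (univ_meas t)).

Lemma comod_hom_from_natural : natural_bijection comod_hom_from.
Proof.
split=> [M N|M M' N N' f g t].
  exists (fun h => univ_hom (Q M N) (meas_uncurry (adj adjT h))) => [t|h].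
    by rewrite /comod_hom_from adjVK meas_curryK univ_measK.
  by rewrite /comod_hom_from univ_homK meas_uncurryK adjK.
apply: (can_inj (@adjK _ _ _ _ adjT _ _)).
rewrite [RHS]adj_nat !adjVK -meas_curry_map.
by congr meas_curry; apply: univ_meas_map.
Qed.

End Tensor.

Theorem proposition8p11 (k : comPzRingType) (m : option nat) :
  [/\ exists alpha : forall M N : Mod k, MDer k m M N -> Meas (Cm k m) M N,
        natural_bijection alpha,
      forall Q : forall M N : rmodule k, universal_comodule M N,
        exists beta : forall M N : Mod k,
            Meas (Cm k m) M N -> Comod_into Q (Cm k m) M N,
          natural_bijection beta,
      forall (Q : forall M N : rmodule k, universal_comodule M N)
             (T : functor (Mod k) (Mod k)),
        adjunction T (conv_functor (Cm k m)) ->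
        exists gamma : forall M N : Mod k,
            Comod_into Q (Cm k m) M N -> hom_from T M N,
          natural_bijection gamma
    & exists K : is_category (@module_derivation k m),
        [/\ forall (M : rmodule k) (n : didx m) (a : rm_alg M),
              mder_alg (mor_id K M) n a = if n == didx0 then a else 0,
            forall (M : rmodule k) (n : didx m) (x : M),
              mder_mod (mor_id K M) n x = if n == didx0 then x else 0,
            forall (M N P : rmodule k) (E : module_derivation m N P)
                   (D : module_derivation m M N) (n : didx m) (a : rm_alg M),
              mder_alg (mor_comp K E D) n a =
                \dsum_(i + j == n) mder_alg E i (mder_alg D j a)
          & forall (M N P : rmodule k) (E : module_derivation m N P)
                   (D : module_derivation m M N) (n : didx m) (x : M),
              mder_mod (mor_comp K E D) n x =
                \dsum_(i + j == n) mder_mod E i (mder_mod D j x)]].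
Proof.
split.
- by exists (@mder_meas k m); apply: mder_meas_natural.
- move=> Q; exists (fun M N => @univ_hom k M N (Q M N) (Cm k m)).
  exact: univ_hom_natural.
- move=> Q T adjT; exists (comod_hom_from adjT).
  exact: comod_hom_from_natural.
exists mder_is_category; split=> *.
- exact: fam_idE.
- exact: fam_idE.
- exact: fam_compE.
- exact: fam_compE.
Qed.
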